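(* Let $u$ be the exact solution of the linear parabolic problem $u'(t)+Au(t)=f(t)$, $0\le t\le T$, $u(0)=u^0$, and let $U:[0,T]\to D(A)$ be the exponential midpoint approximation, i.e. the continuous piecewise linear interpolant of the nodal values $U^0,\dots,U^N$ produced by the exponential midpoint rule with $U^0=u^0$. Let $R(t)=U'(t)+AU(t)-f(t)$, $t\in I_n$, $n=1,\dots,N$, be the residual of $U$, and let $e(t)=u(t)-U(t)$. Then for every $t\in[0,T]$, $$|e(t)|^2+\int_0^t\|e(s)\|^2\,ds\le\int_0^t\|R(s)\|_\star^2\,ds .$$
   Context: $(H,(\cdot,\cdot))$ is a Hilbert space with norm $|\cdot|$, and $A:D(A)\to H$ is a linear, self-adjoint, positive definite operator with $D(A)$ dense in $H$; $\lambda_1>0$ denotes its first eigenvalue. $V:=D(A^{1/2})$ with norm $\|v\|=|A^{1/2}v|$; $V^\star$ is the dual of $V$ ($H$ identified with its dual, $V\subset H\subset V^\star$), with norm $\|v\|_\star=|A^{-1/2}v|$. The Poincaré inequality $|v|\le\lambda_1^{-1/2}\|v\|$ holds for all $v\in V$. The initial value is $u^0\in D(A)$, and $f:[0,T]\to H$ is sufficiently smooth ($f\in C^2([0,T];H)$). Let $0=t^0<t^1<\cdots<t^N=T$, $I_n:=(t^{n-1},t^n]$, $k_n:=t^n-t^{n-1}$, $t^{n-\frac12}:=\frac12(t^{n-1}+t^n)$. Define $\varphi_1(-kA)=\int_0^1e^{-(1-\tau)kA}\,d\tau$, a bounded operator on $H$. The exponential midpoint rule is $U^0=u^0$, $$U^n=e^{-k_nA}U^{n-1}+k_n\varphi_1(-k_nA)f(t^{n-\frac12}),\qquad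 n=1,\dots,N,$$ and the exponential midpoint approximation is $$U(t)=U^{n-1}+(t-t^{n-1})\frac{U^n-U^{n-1}}{k_n},\qquad t\in I_n,$$ with $U(0)=U^0$. On $I_n$, $U'$ denotes the constant $(U^n-U^{n-1})/k_n$. *)

(* Defs.v *)
From Stdlib Require Import Reals.
From Coquelicot Require Import Coquelicot.

Open Scope R_scope.

(* Real Hilbert spaces: the norm carried by the complete normed module is the
   one induced by the inner product. *)
Record HilbertSpace := {
  Hcarrier :> CompleteNormedModule R_AbsRing;
  inner : Hcarrier -> Hcarrier -> R;
  inner_sym : forall x y, inner x y = inner y x;
  inner_plus_l : forall x y z, inner (plus x y) z = inner x z + inner y z;
  inner_scal_l : forall (a : R) x y, inner (scal a x) y = a * inner x y;
  inner_norm : forall x, inner x x = norm x ^ 2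
}.

Arguments inner {h} _ _.

(* Possibly unbounded operators; the values of [app] outside [dom] are
   meaningless. *)
Record operator (H : HilbertSpace) := {
  dom : H -> Prop;
  app :> H -> H
}.

Arguments dom {H} _ _.
Arguments app {H} _ _.

Section Operators.

Context {H : HilbertSpace}.
Implicit Types A B : operator H.

Definition linear_op A : Prop :=
  dom A zero /\
  (forall x y, dom A x -> dom A y ->
     dom A (plus x y) /\ A (plus x y) = plus (A x) (A y)) /\
  (forall (a : R) x, dom A x -> dom A (scal a x) /\ A (scal a x) = scal a (A x)).

Definition densely_defined A : Prop :=
  forall (x : H) (eps : R), 0 < eps -> exists v, dom A v /\ norm (minus v x) < eps.

(* The right-hand side of the equivalence is the graph of the adjoint, so this
   is equality of A and its adjoint, domains included. *)
Definition self_adjoint A : Prop :=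
  forall y z : H,
    (dom A y /\ A y = z) <-> (forall x, dom A x -> inner (A x) y = inner x z).

Definition positive_definite A : Prop :=
  forall v, dom A v -> v <> zero -> 0 < inner (A v) v.

Definition positive_semidefinite A : Prop :=
  forall v, dom A v -> 0 <= inner (A v) v.

Definition eigenvalue A (l : R) : Prop :=
  exists v, dom A v /\ v <> zero /\ A v = scal l v.

Definition first_eigenvalue A (l : R) : Prop :=
  eigenvalue A l /\ forall m, eigenvalue A m -> l <= m.

(* B = A^(1/2): the nonnegative self-adjoint operator with B o B = A, the
   domain of the composition being { v in D(B) | B v in D(B) }. *)
Definition is_sqrt_op A B : Prop :=
  linear_op B /\ densely_defined B /\ self_adjoint B /\ positive_semidefinite B /\
  (forall v, dom A v <-> dom B v /\ dom B (B v)) /\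
  (forall v, dom A v -> A v = B (B v)).

(* Inverse of an operator that is a bijection from its domain onto H. *)
Definition inv_op B (w : H) : H := iota (fun v : H => dom B v /\ B v = w).

(* With B = A^(1/2): the norm of V = D(B), and the norm |A^(-1/2) w| of the
   dual of V on elements w of H. *)
Definition energy_norm B (v : H) : R := norm (B v).
Definition dual_norm B (w : H) : R := norm (inv_op B w).

(* E t = e^(-tA) for t >= 0: E is the strongly continuous semigroup of bounded
   operators whose infinitesimal generator is exactly -A, domain included.
   Nothing is said about E t for t < 0. *)
Definition C0_semigroup (E : R -> H -> H) : Prop :=
  (forall t, 0 <= t -> is_linear (E t)) /\
  (forall x, E 0 x = x) /\
  (forall s t x, 0 <= s -> 0 <= t -> E (s + t) x = E s (E t x)) /\
  (forall x, filterlim (fun t => E t x) (at_right 0) (locally x)).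

Definition exp_minus A (E : R -> H -> H) : Prop :=
  C0_semigroup E /\
  forall x y : H,
    (dom A x /\ A x = y) <->
    filterlim (fun h : R => scal (/ h) (minus (E h x) x)) (at_right 0)
      (locally (opp y)).

(* phi_1(-kA) = int_0^1 e^(-(1-tau)kA) dtau, as a strong integral. *)
Definition phi1 (E : R -> H -> H) (k : R) (x : H) : H :=
  RInt (fun tau : R => E ((1 - tau) * k) x) 0 1.

(* Derivative on [a,b], one-sided at the end points. *)
Definition derivative_on (a b : R) (g g' : R -> H) : Prop :=
  forall t, a <= t <= b ->
    filterlim (fun s : R => scal (/ (s - t)) (minus (g s) (g t)))
      (within (fun s => a <= s <= b) (locally' t)) (locally (g' t)).

Definition C2_on (a b : R) (g : R -> H) : Prop :=
  exists g1 g2 : R -> H,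
    derivative_on a b g g1 /\ derivative_on a b g1 g2 /\
    continuous_on (fun s : R => a <= s <= b) g2.

(* u' + A u = f on [0,T], u(0) = u0. *)
Definition exact_solution A (f : R -> H) (u0 : H) (T : R) (u : R -> H) : Prop :=
  u 0 = u0 /\
  exists u' : R -> H,
    derivative_on 0 T u u' /\
    forall t, 0 <= t <= T -> dom A (u t) /\ plus (u' t) (A (u t)) = f t.

End Operators.

Definition partition (N : nat) (T : R) (tn : nat -> R) : Prop :=
  (1 <= N)%nat /\ tn 0%nat = 0 /\ tn N = T /\
  forall n, (n < N)%nat -> tn n < tn (S n).

(* The index n - 1 of the interval I_n = (t^(n-1), t^n] containing s: the
   largest m < N with tn m < s. It is 0 for s = 0. *)
Fixpoint cell (tn : nat -> R) (N : nat) (s : R) : nat :=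
  match N with
  | O => O
  | S m => if Rlt_dec (tn m) s then m else cell tn m s
  end.

Section ExponentialMidpoint.

Context {H : HilbertSpace}.
Variables (A : operator H) (E : R -> H -> H) (f : R -> H) (u0 : H).
Variables (N : nat) (tn : nat -> R).

Fixpoint midpoint_node (n : nat) : H :=
  match n with
  | O => u0
  | S m =>
      let k := tn (S m) - tn m in
      plus (E k (midpoint_node m))
           (scal k (phi1 E k (f ((tn m + tn (S m)) / 2))))
  end.

Definition midpoint_slope (s : R) : H :=
  let m := cell tn N s in
  scal (/ (tn (S m) - tn m)) (minus (midpoint_node (S m)) (midpoint_node m)).

Definition midpoint_approx (s : R) : H :=
  let m := cell tn N s in
  plus (midpoint_node m) (scal (s - tn m) (midpoint_slope s)).

(* The value at s = 0, which lies in no I_n, is that of the formula on I_1. *)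
Definition residual (s : R) : H :=
  minus (plus (midpoint_slope s) (A (midpoint_approx s))) (f s).

End ExponentialMidpoint.

(* Main.v *)
Require Import Defs.
From Stdlib Require Import Reals Lra Lia Classical ClassicalEpsilon.
From Coquelicot Require Import Coquelicot.

Open Scope R_scope.

(* On each I_n the error satisfies e' = -(A e + R). Testing with e and writing
   R = A^(1/2) w gives
     (|e|^2)' = -2 ||e||^2 - 2 (w, A^(1/2) e) <= -||e||^2 + |w|^2,
   which is integrated over the successive intervals; e is continuous and
   e(0) = 0. The rest is regularity. A^(1/2) is onto, being self-adjoint and
   bounded below (Poincare), so |w| is the dual norm of R. The semigroup maps
   D(A) into itself and k phi_1(-kA) x = int_0^k e^(-sA) x ds lies in D(A), so
   the nodal values are in D(A). Finally u is only assumed differentiable: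
   comparing u with its translates bounds u', hence A u, and therefore
   A^(1/2) u is continuous and the integrals exist. *)

(** * Inner product *)

(** The constant 1 in the bound comes from the factor 2 in (|e|^2)' = 2 (e', e): Young's inequality
    2ab <= a^2 + b^2 uses up just one of the two copies of ||e||^2. The obstacle is that A^(1/2) is
    unbounded, so continuity of u in H does not make ||e||^2 Riemann integrable. The interpolation
    |A^(1/2) v|^2 = (A v, v) <= |A v| |v| does so once A u is bounded. Translates give that bound
    because u(. + h) - u solves the same equation with datum f(. + h) - f, which is of size O(h); no
    representation of u through the semigroup enters. U has corners at the nodes, hence derivatives
    relative to a closed interval. The semigroup serves only to place the nodal values in D(A). No
    spectral calculus is used: local boundedness of the semigroup is drawn from strong continuity by
    a category argument, and A^(-1/2) from the projection theorem. *)

Section InnerProduct.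

Context {H : HilbertSpace}.
Implicit Types x y z : H.

Lemma inner_plus_r x y z : inner x (plus y z) = inner x y + inner x z.
Proof. now rewrite inner_sym, inner_plus_l, !(inner_sym _ x). Qed.

Lemma inner_scal_r (a : R) x y : inner x (scal a y) = a * inner x y.
Proof. now rewrite inner_sym, inner_scal_l, (inner_sym _ x). Qed.

Lemma inner_opp_l x y : inner (opp x) y = - inner x y.
Proof.
  assert (Hx : opp x = scal (-1 : R) x) by (symmetry; exact (scal_opp_one x)).
  rewrite Hx, inner_scal_l; ring.
Qed.

Lemma inner_opp_r x y : inner x (opp y) = - inner x y.
Proof. now rewrite inner_sym, inner_opp_l, inner_sym. Qed.

Lemma inner_minus_l x y z : inner (minus x y) z = inner x z - inner y z.
Proof. unfold minus; rewrite inner_plus_l, inner_opp_l; ring. Qed.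

Lemma inner_minus_r x y z : inner x (minus y z) = inner x y - inner x z.
Proof. unfold minus; rewrite inner_plus_r, inner_opp_r; ring. Qed.

Lemma inner_zero_l x : inner zero x = 0.
Proof.
  assert (H0 : (zero : H) = scal (0 : R) zero) by (symmetry; exact (scal_zero_l zero)).
  rewrite H0, inner_scal_l; ring.
Qed.

Lemma inner_zero_r x : inner x zero = 0.
Proof. now rewrite inner_sym, inner_zero_l. Qed.

Lemma inner_ext x y : (forall z, inner x z = inner y z) -> x = y.
Proof.
  intros Hxy.
  assert (Hn : norm (minus x y) = 0).
  { assert (Hi : norm (minus x y) ^ 2 = 0).
    { rewrite <- (inner_norm H), inner_minus_l, Hxy; ring. }
    generalize (norm_ge_0 (minus x y)); nra. }
  apply norm_eq_zero in Hn.
  apply (plus_reg_r (opp y)); rewrite plus_opp_r; exact Hn.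
Qed.

End InnerProduct.

(* Matching on the head symbols instead of rewriting with the lemmas above, since
   the algebraic structure on H may be reached along several coercion paths. *)
Ltac inner_expand :=
  match goal with
  | |- context [@inner ?h ?w ?z] =>
      let e := lazymatch w with
        | @minus _ ?x ?y => constr:(inner_minus_l (H := h) x y z)
        | @plus _ ?x ?y => constr:(inner_plus_l h x y z)
        | @scal _ _ ?a ?x => constr:(inner_scal_l h a x z)
        | @opp _ ?x => constr:(inner_opp_l (H := h) x z)
        | @zero _ => constr:(inner_zero_l (H := h) z)
        | _ => lazymatch z with
          | @minus _ ?x ?y => constr:(inner_minus_r (H := h) w x y)
          | @plus _ ?x ?y => constr:(inner_plus_r (H := h) w x y)
          | @scal _ _ ?a ?x => constr:(inner_scal_r (H := h) a w x)
          | @opp _ ?x => constr:(inner_opp_r (H := h) w x)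
          | @zero _ => constr:(inner_zero_r (H := h) w)
          end
        end in
      lazymatch type of e with
      | _ = ?r => replace (@inner h w z) with r by (symmetry; exact e)
      end
  end.

(* Decides linear identities in H by pairing both sides with an arbitrary
   vector. *)
Ltac vec_simpl :=
  apply inner_ext; let z := fresh "z" in intros z;
  repeat inner_expand.
Ltac vec_ring := vec_simpl; ring.

Section HilbertNorm.

Context {H : HilbertSpace}.
Implicit Types x y z : H.

Lemma norm_scal_eq (a : R) x : norm (scal a x) = Rabs a * norm x.
Proof.
  apply Rsqr_inj.
  - apply norm_ge_0.
  - apply Rmult_le_pos; [apply Rabs_pos | apply norm_ge_0].
  - replace (Rsqr (norm (scal a x))) with (norm (scal a x) ^ 2)
      by (unfold Rsqr; ring).
    rewrite <- (inner_norm H), inner_scal_l, inner_scal_r, inner_norm.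
    rewrite Rsqr_mult, <- Rsqr_abs; unfold Rsqr; ring.
Qed.

Lemma Cauchy_Schwarz x y : Rabs (inner x y) <= norm x * norm y.
Proof.
  assert (Hd : forall t : R, 0 <= norm x ^ 2 + 2 * t * inner x y + t ^ 2 * norm y ^ 2).
  { intros t; rewrite <- !(inner_norm H).
    replace (inner x x + 2 * t * inner x y + t ^ 2 * inner y y)
      with (inner (plus x (scal t y)) (plus x (scal t y))).
    - rewrite inner_norm; apply pow2_ge_0.
    - repeat inner_expand; rewrite (inner_sym _ y x); ring. }
  generalize (norm_ge_0 x) (norm_ge_0 y); intros Hx Hy.
  destruct (Req_dec (norm y) 0) as [Hy0 | Hy0].
  - assert (y = zero) as -> by exact (norm_eq_zero y Hy0).
    rewrite inner_zero_r, Rabs_R0; nra.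
  (* This t minimises the quadratic in [Hd]. *)
  - specialize (Hd (- inner x y / norm y ^ 2)).
    assert (Hs : inner x y ^ 2 <= (norm x * norm y) ^ 2).
    { replace (norm x ^ 2 + 2 * (- inner x y / norm y ^ 2) * inner x y
        + (- inner x y / norm y ^ 2) ^ 2 * norm y ^ 2)
        with (norm x ^ 2 - inner x y ^ 2 / norm y ^ 2) in Hd by (field; lra).
      assert (Hy2 : 0 < norm y ^ 2) by nra.
      apply Rmult_le_compat_r with (r := norm y ^ 2) in Hd; [ | lra].
      replace ((norm x ^ 2 - inner x y ^ 2 / norm y ^ 2) * norm y ^ 2)
        with ((norm x * norm y) ^ 2 - inner x y ^ 2) in Hd by (field; lra).
      lra. }
    rewrite <- (Rabs_pos_eq (norm x * norm y)) by nra.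
    apply Rsqr_le_abs_0; unfold Rsqr; nra.
Qed.

Lemma inner_le x y : inner x y <= norm x * norm y.
Proof. eapply Rle_trans; [apply Rle_abs | apply Cauchy_Schwarz]. Qed.

Lemma norm_minus_sym x y : norm (minus x y) = norm (minus y x).
Proof.
  replace (minus y x) with (opp (minus x y)) by vec_ring.
  symmetry; apply (@norm_opp R_AbsRing H).
Qed.

Lemma norm_minus_triangle x y z :
  norm (minus x z) <= norm (minus x y) + norm (minus y z).
Proof.
  replace (minus x z) with (plus (minus x y) (minus y z)) by vec_ring.
  apply (@norm_triangle R_AbsRing H).
Qed.

Lemma norm_minus_le x y : norm (minus x y) <= norm x + norm y.
Proof.
  rewrite <- (@norm_opp R_AbsRing H y); apply (@norm_triangle R_AbsRing H).
Qed.

Lemma norm_sqr_inner x : norm x ^ 2 = inner x x.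
Proof. symmetry; apply inner_norm. Qed.

End HilbertNorm.

(** * Functions of a real variable *)

(** Composing with this projection onto [a,b] turns continuity relative to [a,b] into continuity on
    the whole line, the form in which the mean value theorem and integrability results can be
    applied. *)
Definition clamp (a b t : R) : R := Rmax a (Rmin t b).

Lemma clamp_in a b t : a <= b -> a <= clamp a b t <= b.
Proof. intros; unfold clamp, Rmax, Rmin; repeat destruct Rle_dec; lra. Qed.

Lemma clamp_id a b t : a <= t <= b -> clamp a b t = t.
Proof. intros; unfold clamp, Rmax, Rmin; repeat destruct Rle_dec; lra. Qed.

Lemma clamp_lipschitz a b s t : Rabs (clamp a b s - clamp a b t) <= Rabs (s - t).
Proof.
  unfold clamp, Rmax, Rmin; repeat destruct Rle_dec;
    unfold Rabs; repeat destruct Rcase_abs; lra.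
Qed.

Lemma continuous_clamp {V : UniformSpace} a b (g : R -> V) :
  a <= b -> continuous_on (fun s => a <= s <= b) g ->
  forall t, continuous (fun s => g (clamp a b s)) t.
Proof.
  intros Hab Hg t.
  apply filterlim_comp with (G := within (fun s => a <= s <= b) (locally (clamp a b t))).
  2: now apply Hg, clamp_in.
  intros P [d Hd]; exists d; intros s Hs.
  apply Hd; [ | now apply clamp_in].
  eapply Rle_lt_trans; [apply clamp_lipschitz | exact Hs].
Qed.

Lemma continuous_on_sub {V : UniformSpace} a b c d (g : R -> V) :
  a <= c -> d <= b ->
  continuous_on (fun s => a <= s <= b) g -> continuous_on (fun s => c <= s <= d) g.
Proof.
  intros Hc Hd Hg t Ht P HP.
  destruct (Hg t ltac:(lra) P HP) as [r Hr]; exists r; intros s Hs Hs'.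
  apply Hr; [exact Hs | lra].
Qed.

Lemma continuous_onI {V : NormedModule R_AbsRing} a b (g : R -> V) :
  (forall t, a <= t <= b -> forall eps, 0 < eps -> exists d, 0 < d /\
     forall s, a <= s <= b -> Rabs (s - t) < d -> norm (minus (g s) (g t)) < eps) ->
  continuous_on (fun s => a <= s <= b) g.
Proof.
  intros Hg t Ht.
  apply filterlim_locally_ball_norm; intros eps.
  destruct (Hg t Ht eps (cond_pos eps)) as [d [Hd Hs]].
  exists (mkposreal d Hd); intros s Hst Hsab; now apply Hs.
Qed.

Lemma continuous_onE {V : NormedModule R_AbsRing} a b (g : R -> V) :
  continuous_on (fun s => a <= s <= b) g ->
  forall t, a <= t <= b -> forall eps, 0 < eps -> exists d, 0 < d /\
     forall s, a <= s <= b -> Rabs (s - t) < d -> norm (minus (g s) (g t)) < eps.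
Proof.
  intros Hg t Ht eps Heps.
  destruct (proj1 (filterlim_locally_ball_norm _ _) (Hg t Ht) (mkposreal eps Heps))
    as [d Hd].
  exists d; split; [apply cond_pos | ].
  intros s Hs Hst; now apply Hd.
Qed.

Lemma continuous_on_minus {V : NormedModule R_AbsRing} a b (g h : R -> V) :
  continuous_on (fun s => a <= s <= b) g -> continuous_on (fun s => a <= s <= b) h ->
  continuous_on (fun s => a <= s <= b) (fun s => minus (g s) (h s)).
Proof.
  intros Hg Hh t Ht.
  apply (filterlim_comp_2 (G := locally (g t)) (H := locally (opp (h t)))
           g (fun s => opp (h s)) plus).
  - now apply Hg.
  - exact (filterlim_comp _ _ _ h opp _ _ _ (Hh t Ht) (filterlim_opp (h t))).
  - apply filterlim_plus.
Qed.

Lemma continuous_on_norm_sqr {V : NormedModule R_AbsRing} a b (g : R -> V) :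
  continuous_on (fun s => a <= s <= b) g ->
  continuous_on (fun s => a <= s <= b) (fun s => norm (g s) ^ 2).
Proof.
  intros Hg t Ht.
  apply (filterlim_comp _ _ _ g (fun v => norm v ^ 2) _ (locally (g t)));
    [now apply Hg | ].
  apply (filterlim_comp _ _ _ norm (fun r : R => r ^ 2) _ (locally (norm (g t))));
    [apply filterlim_norm | ].
  apply (ex_derive_continuous (fun r : R => r ^ 2)); auto_derive; exact I.
Qed.

Lemma continuous_on_bounded {V : NormedModule R_AbsRing} a b (g : R -> V) :
  a <= b -> continuous_on (fun s => a <= s <= b) g ->
  exists M, 0 <= M /\ forall s, a <= s <= b -> norm (g s) <= M.
Proof.
  intros Hab Hg.
  destruct (continuity_ab_maj (fun s => norm (g (clamp a b s))) a b Hab) as [m [Hm _]].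
  - intros c _; apply continuity_pt_filterlim.
    apply (filterlim_comp _ _ _ (fun s => g (clamp a b s)) norm _
             (locally (g (clamp a b c)))).
    + now apply continuous_clamp.
    + apply filterlim_norm.
  - exists (norm (g (clamp a b m))); split; [apply norm_ge_0 | ].
    intros s Hs; specialize (Hm s Hs); now rewrite (clamp_id a b s Hs) in Hm.
Qed.

Lemma continuous_on_ex_RInt {V : CompleteNormedModule R_AbsRing} a b (g : R -> V) :
  a <= b -> continuous_on (fun s => a <= s <= b) g -> ex_RInt g a b.
Proof.
  intros Hab Hg.
  apply ex_RInt_ext with (fun s => g (clamp a b s)).
  - intros s; rewrite Rmin_left, Rmax_right by assumption; intros Hs.
    rewrite clamp_id; [easy | lra].
  - apply ex_RInt_continuous; intros; now apply continuous_clamp.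
Qed.

(* [l] is the derivative at [t] of [g] restricted to [a,b], hence one-sided at
   the end points. *)
Definition has_deriv {V : NormedModule R_AbsRing} (a b : R) (g : R -> V) (t : R)
    (l : V) : Prop :=
  forall eps, 0 < eps -> exists d, 0 < d /\
    forall s, a <= s <= b -> Rabs (s - t) < d ->
      norm (minus (minus (g s) (g t)) (scal (s - t) l)) <= eps * Rabs (s - t).

Lemma has_deriv_sub {V : NormedModule R_AbsRing} a b c d (g : R -> V) t l :
  a <= c -> d <= b -> has_deriv a b g t l -> has_deriv c d g t l.
Proof.
  intros Hc Hd Hg eps Heps.
  destruct (Hg eps Heps) as [r [Hr Hs]].
  exists r; split; [exact Hr | ]; intros s Hscd; apply Hs; lra.
Qed.

Lemma has_deriv_plus_real a b (g h : R -> R) t l m :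
  has_deriv a b g t l -> has_deriv a b h t m ->
  has_deriv a b (fun s => g s + h s) t (l + m).
Proof.
  intros Hg Hh eps Heps.
  destruct (Hg (eps / 2) ltac:(lra)) as [r [Hr Hgs]].
  destruct (Hh (eps / 2) ltac:(lra)) as [r' [Hr' Hhs]].
  exists (Rmin r r'); split; [now apply Rmin_pos | ].
  intros s Hs Hst.
  specialize (Hgs s Hs (Rlt_le_trans _ _ _ Hst (Rmin_l _ _))).
  specialize (Hhs s Hs (Rlt_le_trans _ _ _ Hst (Rmin_r _ _))).
  change (Rabs ((g s + - g t) + - ((s - t) * l)) <= eps / 2 * Rabs (s - t)) in Hgs.
  change (Rabs ((h s + - h t) + - ((s - t) * m)) <= eps / 2 * Rabs (s - t)) in Hhs.
  change (Rabs ((g s + h s + - (g t + h t)) + - ((s - t) * (l + m)))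
    <= eps * Rabs (s - t)).
  replace ((g s + h s + - (g t + h t)) + - ((s - t) * (l + m))) with
    (((g s + - g t) + - ((s - t) * l)) + ((h s + - h t) + - ((s - t) * m))) by ring.
  eapply Rle_trans; [apply Rabs_triang | lra].
Qed.

Lemma has_deriv_of_is_derive {V : NormedModule R_AbsRing} a b (g : R -> V) t l :
  is_derive g t l -> has_deriv a b g t l.
Proof.
  intros [_ Hd] eps Heps.
  destruct (Hd t (fun P HP => HP) (mkposreal eps Heps)) as [d Hd'].
  exists d; split; [apply cond_pos | ]; intros s _ Hst; exact (Hd' s Hst).
Qed.

Lemma has_deriv_continuous_on {V : NormedModule R_AbsRing} a b (g g' : R -> V) :
  (forall t, a <= t <= b -> has_deriv a b g t (g' t)) ->
  continuous_on (fun s => a <= s <= b) g.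
Proof.
  intros Hg; apply continuous_onI; intros t Ht eps Heps.
  destruct (Hg t Ht 1 Rlt_0_1) as [d [Hd Hs]].
  generalize (norm_ge_0 (g' t)); intros Hn.
  exists (Rmin d (eps / (2 + norm (g' t)))); split.
  { apply Rmin_pos; [exact Hd | apply Rdiv_lt_0_compat; lra]. }
  intros s Hsab Hst.
  specialize (Hs s Hsab (Rlt_le_trans _ _ _ Hst (Rmin_l _ _))).
  assert (Hst' := Rlt_le_trans _ _ _ Hst (Rmin_r _ _)).
  apply Rmult_lt_compat_r with (r := 2 + norm (g' t)) in Hst'; [ | lra].
  unfold Rdiv in Hst'; rewrite Rmult_assoc, Rinv_l, Rmult_1_r in Hst' by lra.
  replace (minus (g s) (g t)) with
    (plus (minus (minus (g s) (g t)) (scal (s - t) (g' t))) (scal (s - t) (g' t))).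
  2:{ unfold minus at 1; rewrite <- plus_assoc, plus_opp_l, plus_zero_r; easy. }
  eapply Rle_lt_trans; [apply norm_triangle | ].
  assert (Hsc : norm (scal (s - t) (g' t)) <= Rabs (s - t) * norm (g' t))
    by apply (@norm_scal R_AbsRing V (s - t) (g' t)).
  generalize (Rabs_pos (s - t)); nra.
Qed.

(** The mean value theorem asks for two-sided derivatives only in the open interval, so it applies
    to the clamped function even though the derivatives at a and b are one-sided. *)
Lemma has_deriv_nonpos_le a b (g g' : R -> R) :
  a <= b -> (forall t, a <= t <= b -> has_deriv a b g t (g' t)) ->
  (forall t, a <= t <= b -> g' t <= 0) -> g b <= g a.
Proof.
  intros Hab Hg Hneg.
  destruct (MVT_gen (fun s => g (clamp a b s)) a b g') as [c [Hc Hmvt]].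
  - rewrite Rmin_left, Rmax_right by assumption; intros t Ht.
    apply is_derive_Reals; intros eps Heps.
    destruct (Hg t ltac:(lra) (eps / 2) ltac:(lra)) as [d [Hd Hs]].
    (* The inner minimum keeps t + h inside [a,b], where the clamp is the identity. *)
    assert (Hd' : 0 < Rmin d (Rmin (t - a) (b - t))).
    { repeat apply Rmin_pos; lra. }
    exists (mkposreal _ Hd'); intros h Hh Hhd; simpl in Hhd.
    assert (H1 := Rlt_le_trans _ _ _ Hhd (Rmin_l _ _)).
    assert (H2 := Rlt_le_trans _ _ _ Hhd (Rmin_r _ _)).
    assert (H3 := Rlt_le_trans _ _ _ H2 (Rmin_l _ _)).
    assert (H4 := Rlt_le_trans _ _ _ H2 (Rmin_r _ _)).
    apply Rabs_def2 in H3; apply Rabs_def2 in H4.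
    rewrite !clamp_id by lra.
    specialize (Hs (t + h) ltac:(lra)).
    replace (t + h - t) with h in Hs by ring.
    specialize (Hs H1).
    change (Rabs ((g (t + h) + - g t) + - (h * g' t)) <= eps / 2 * Rabs h) in Hs.
    replace ((g (t + h) - g t) / h - g' t) with
      (((g (t + h) + - g t) + - (h * g' t)) * / h) by (field; exact Hh).
    rewrite Rabs_mult, Rabs_inv.
    assert (Hp : 0 < Rabs h) by now apply Rabs_pos_lt.
    apply Rle_lt_trans with (eps / 2); [ | lra].
    apply Rmult_le_reg_r with (Rabs h); [exact Hp | ].
    rewrite Rmult_assoc, Rinv_l, Rmult_1_r; lra.
  - intros t _; apply continuity_pt_filterlim.
    apply (continuous_clamp a b g Hab).
    now apply (has_deriv_continuous_on (V := R_NormedModule) a b g g').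
  - rewrite Rmin_left, Rmax_right in Hc by assumption.
    rewrite !clamp_id in Hmvt by lra.
    specialize (Hneg c Hc); nra.
Qed.

(** The function g minus the primitive of h is nonincreasing. Only the majorant h is integrated, so
    g' may be discontinuous, as u' may be in the application. *)
Lemma has_deriv_le_RInt a b (g g' h : R -> R) :
  a <= b -> (forall t, a <= t <= b -> has_deriv a b g t (g' t)) ->
  continuous_on (fun s => a <= s <= b) h ->
  (forall t, a <= t <= b -> g' t <= h t) -> g b - g a <= RInt h a b.
Proof.
  intros Hab Hg Hh Hle.
  set (hc := fun s => h (clamp a b s)).
  assert (Hc : forall t, continuous hc t)
    by (intros; now apply (continuous_clamp a b h)).
  assert (Hx : RInt h a b = RInt hc a b).
  { apply RInt_ext; rewrite Rmin_left, Rmax_right by assumption; intros s Hs.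
    unfold hc; rewrite clamp_id; [easy | lra]. }
  rewrite Hx.
  assert (Hm : g b + - RInt hc a b <= g a + - RInt hc a a).
  { apply (has_deriv_nonpos_le a b (fun s => g s + - RInt hc a s)
             (fun t => g' t + - hc t)); [exact Hab | | ].
    - intros t Ht; apply has_deriv_plus_real; [now apply Hg | ].
      apply has_deriv_of_is_derive.
      apply (is_derive_opp (fun s => RInt hc a s)).
      apply is_derive_RInt with (a := a); [ | apply Hc].
      apply filter_forall; intros s.
      apply (RInt_correct (V := R_CompleteNormedModule)).
      apply ex_RInt_continuous; intros; apply Hc.
    - intros t Ht; unfold hc; rewrite clamp_id by assumption.
      specialize (Hle t Ht); lra. }
  rewrite RInt_point in Hm; change (@zero R_CompleteNormedModule) with 0 in Hm; lra.
Qed.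

Section HilbertDerivative.

Context {H : HilbertSpace}.

(* [has_deriv] with the algebraic operations taken in H rather than in its
   underlying normed module: convertible, but not for [rewrite]. *)
Lemma has_derivP a b (g : R -> H) t (l : H) :
  has_deriv a b g t l <->
  forall eps, 0 < eps -> exists d, 0 < d /\
    forall s, a <= s <= b -> Rabs (s - t) < d ->
      norm (minus (minus (g s) (g t)) (scal (s - t) l)) <= eps * Rabs (s - t).
Proof. reflexivity. Qed.

Lemma norm_zero_eq (x : H) : x = zero -> norm x = 0.
Proof. intros ->; apply (@norm_zero R_AbsRing H). Qed.

Lemma derivative_on_has_deriv a b (g g' : R -> H) t :
  derivative_on a b g g' -> a <= t <= b -> has_deriv a b g t (g' t).
Proof.
  intros Hg Ht; apply has_derivP; intros eps Heps.
  destruct (proj1 (filterlim_locally_ball_norm _ _) (Hg t Ht) (mkposreal eps Heps))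
    as [d Hd].
  exists d; split; [apply cond_pos | ]; intros s Hs Hst.
  destruct (Req_dec s t) as [-> | Hne].
  - rewrite norm_zero_eq by vec_ring.
    rewrite Rminus_diag, Rabs_R0, Rmult_0_r; apply Rle_refl.
  - assert (Hn : norm (minus (scal (/ (s - t)) (minus (g s) (g t))) (g' t)) < eps)
      by exact (Hd s Hst Hne Hs).
    replace (minus (minus (g s) (g t)) (scal (s - t) (g' t))) with
      (scal (s - t) (minus (scal (/ (s - t)) (minus (g s) (g t))) (g' t))).
    + rewrite norm_scal_eq; generalize (Rabs_pos (s - t)); nra.
    + vec_simpl; field; lra.
Qed.

Lemma has_deriv_minus a b (g h : R -> H) t (l m : H) :
  has_deriv a b g t l -> has_deriv a b h t m ->
  has_deriv a b (fun s => minus (g s) (h s)) t (minus l m).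
Proof.
  rewrite !has_derivP; intros Hg Hh eps Heps.
  destruct (Hg (eps / 2) ltac:(lra)) as [r [Hr Hgs]].
  destruct (Hh (eps / 2) ltac:(lra)) as [r' [Hr' Hhs]].
  exists (Rmin r r'); split; [now apply Rmin_pos | ].
  intros s Hs Hst.
  specialize (Hgs s Hs (Rlt_le_trans _ _ _ Hst (Rmin_l _ _))).
  specialize (Hhs s Hs (Rlt_le_trans _ _ _ Hst (Rmin_r _ _))).
  replace (minus (minus (minus (g s) (h s)) (minus (g t) (h t))) (scal (s - t) (minus l m)))
    with (minus (minus (minus (g s) (g t)) (scal (s - t) l))
                (minus (minus (h s) (h t)) (scal (s - t) m))) by vec_ring.
  eapply Rle_trans; [apply norm_minus_le | lra].
Qed.

Lemma has_deriv_affine a b c (p q : H) t :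
  has_deriv a b (fun s => plus p (scal (s - c) q)) t q.
Proof.
  apply has_derivP; intros eps Heps; exists 1; split; [lra | ]; intros s _ _.
  rewrite norm_zero_eq by vec_ring.
  apply Rmult_le_pos; [lra | apply Rabs_pos].
Qed.

Lemma has_deriv_shift a b c d k (g : R -> H) t (l : H) :
  a <= c + k -> d + k <= b ->
  has_deriv a b g (t + k) l -> has_deriv c d (fun s => g (s + k)) t l.
Proof.
  intros Hc Hd Hg eps Heps.
  destruct (Hg eps Heps) as [r [Hr Hs]].
  exists r; split; [exact Hr | ]; intros s Hscd Hst.
  specialize (Hs (s + k) ltac:(lra)).
  replace (s + k - (t + k)) with (s - t) in Hs by ring; now apply Hs.
Qed.

Lemma has_deriv_inner_const a b (g : R -> H) t (l z : H) :
  has_deriv a b g t l -> has_deriv a b (fun s => inner (g s) z) t (inner l z).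
Proof.
  intros Hg eps Heps; rewrite has_derivP in Hg.
  generalize (norm_ge_0 z); intros Hz.
  destruct (Hg (eps / (1 + norm z))) as [d [Hd Hs]].
  { apply Rdiv_lt_0_compat; lra. }
  exists d; split; [exact Hd | ]; intros s Hsab Hst; specialize (Hs s Hsab Hst).
  change (Rabs ((inner (g s) z - inner (g t) z) - (s - t) * inner l z)
            <= eps * Rabs (s - t)).
  rewrite <- inner_scal_l, <- !inner_minus_l.
  eapply Rle_trans; [apply Cauchy_Schwarz | ].
  generalize (Rabs_pos (s - t)); intros Hp.
  apply Rle_trans with (eps / (1 + norm z) * Rabs (s - t) * (1 + norm z)).
  - apply Rmult_le_compat; try apply norm_ge_0; lra.
  - right; field; lra.
Qed.

(** With D = g s - g t, |g s|^2 - |g t|^2 = 2 (D, g t) + |D|^2, and the last term is quadratic in s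
    - t. *)
Lemma has_deriv_norm_sqr a b (g : R -> H) t (l : H) :
  has_deriv a b g t l ->
  has_deriv a b (fun s => norm (g s) ^ 2) t (2 * inner l (g t)).
Proof.
  intros Hg eps Heps; rewrite has_derivP in Hg.
  generalize (norm_ge_0 (g t)) (norm_ge_0 l); intros Hgt Hl.
  (* The bound 1 gives |D| <= (1 + |l|) |s - t|; the other one limits the linear remainder 2 (r, g
     t) to eps/2 |s - t|. The radius chosen below leaves the other eps/2 for |D|^2. *)
  set (e1 := Rmin 1 (eps / (4 * (1 + norm (g t))))).
  assert (He1 : 0 < e1).
  { apply Rmin_pos; [lra | apply Rdiv_lt_0_compat; lra]. }
  assert (He1' : e1 <= 1) by apply Rmin_l.
  assert (He1'' : e1 * (4 * (1 + norm (g t))) <= eps).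
  { apply Rle_trans with (eps / (4 * (1 + norm (g t))) * (4 * (1 + norm (g t)))).
    - apply Rmult_le_compat_r; [lra | apply Rmin_r].
    - right; field; lra. }
  destruct (Hg e1 He1) as [d [Hd Hs]].
  assert (Hq : 0 < 2 * (1 + norm l) ^ 2) by nra.
  exists (Rmin d (eps / (2 * (1 + norm l) ^ 2))); split.
  { apply Rmin_pos; [exact Hd | now apply Rdiv_lt_0_compat]. }
  intros s Hsab Hst.
  specialize (Hs s Hsab (Rlt_le_trans _ _ _ Hst (Rmin_l _ _))).
  assert (Hst' := Rlt_le_trans _ _ _ Hst (Rmin_r _ _)).
  apply Rmult_lt_compat_r with (r := 2 * (1 + norm l) ^ 2) in Hst'; [ | lra].
  unfold Rdiv in Hst'; rewrite Rmult_assoc, Rinv_l, Rmult_1_r in Hst' by lra.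
  set (D := minus (g s) (g t)) in *.
  set (r := minus D (scal (s - t) l)) in *.
  generalize (Rabs_pos (s - t)); intros Hp.
  assert (HD : norm D <= (1 + norm l) * Rabs (s - t)).
  { replace D with (plus r (scal (s - t) l)) by (unfold r; vec_ring).
    eapply Rle_trans; [apply (@norm_triangle R_AbsRing H) | ].
    rewrite norm_scal_eq; nra. }
  change (Rabs ((norm (g s) ^ 2 - norm (g t) ^ 2) - (s - t) * (2 * inner l (g t)))
            <= eps * Rabs (s - t)).
  replace ((norm (g s) ^ 2 - norm (g t) ^ 2) - (s - t) * (2 * inner l (g t)))
    with (2 * inner r (g t) + norm D ^ 2).
  2:{ unfold r, D; rewrite !norm_sqr_inner; repeat inner_expand.
      rewrite (inner_sym _ (g t) (g s)); ring. }
  eapply Rle_trans; [apply Rabs_triang | ].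
  rewrite Rabs_mult, (Rabs_pos_eq 2), (Rabs_pos_eq (norm D ^ 2))
    by (try apply pow2_ge_0; lra).
  generalize (Cauchy_Schwarz r (g t)) (norm_ge_0 r) (norm_ge_0 D); intros HC Hr HD0.
  assert (H1 : norm r * norm (g t) <= e1 * Rabs (s - t) * norm (g t))
    by (apply Rmult_le_compat_r; lra).
  assert (H2 : norm D ^ 2 <= ((1 + norm l) * Rabs (s - t)) ^ 2)
    by (apply pow_incr; lra).
  assert (H3 : e1 * (1 + norm (g t)) * Rabs (s - t) <= eps / 4 * Rabs (s - t))
    by (apply Rmult_le_compat_r; lra).
  assert (H4 : Rabs (s - t) * (2 * (1 + norm l) ^ 2) * Rabs (s - t)
    <= eps * Rabs (s - t)) by (apply Rmult_le_compat_r; lra).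
  nra.
Qed.

(** Reduction to the scalar case: pair g with z = g t - g s, so that (g r, z) - M |z| r is
    nonincreasing in r, then divide by |z|. *)
Lemma has_deriv_lipschitz a b (g g' : R -> H) M :
  (forall t, a <= t <= b -> has_deriv a b g t (g' t)) ->
  (forall t, a <= t <= b -> norm (g' t) <= M) ->
  forall s t, a <= s -> s <= t -> t <= b -> norm (minus (g t) (g s)) <= M * (t - s).
Proof.
  intros Hg HM s t Hs Hst Ht.
  set (z := minus (g t) (g s)).
  assert (Hm : inner (g t) z + - (M * norm z) * t <= inner (g s) z + - (M * norm z) * s).
  { apply (has_deriv_nonpos_le s t (fun r => inner (g r) z + - (M * norm z) * r)
      (fun r => inner (g' r) z + - (M * norm z))); [exact Hst | | ].
    - intros r Hr; apply has_deriv_plus_real.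
      + apply has_deriv_inner_const, (has_deriv_sub a b); try lra.
        apply Hg; lra.
      + apply has_deriv_of_is_derive; auto_derive; [easy | ring].
    - intros r Hr; generalize (inner_le (g' r) z) (HM r ltac:(lra)) (norm_ge_0 z); nra. }
  assert (Hz : norm z ^ 2 = inner (g t) z - inner (g s) z)
    by (unfold z at 1; rewrite norm_sqr_inner, inner_minus_l; easy).
  generalize (norm_ge_0 z) (norm_ge_0 (g' s)) (HM s ltac:(lra)); intros Hz0 H0 H1.
  destruct (Req_dec (norm z) 0) as [E | E]; [rewrite E; nra | ].
  apply Rmult_le_reg_r with (norm z); nra.
Qed.

End HilbertDerivative.

(** * Completeness and operators bounded below *)

Section Completeness.

Context {H : HilbertSpace}.

(** The sets S e are the base of a Cauchy filter. Phrasing completeness with sets avoids choosing a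
    sequence; it serves for minimising vectors, for approximate preimages and for centres of nested
    balls. *)
Lemma shrinking_sets_limit (S : R -> H -> Prop) :
  (forall e, 0 < e -> exists v, S e v) ->
  (forall e e' v, 0 < e -> e <= e' -> S e v -> S e' v) ->
  (forall eta, 0 < eta -> exists e, 0 < e /\
     forall v w, S e v -> S e w -> norm (minus v w) < eta) ->
  exists y : H, forall eta, 0 < eta -> exists e, 0 < e /\
    forall v, S e v -> norm (minus v y) < eta.
Proof.
  intros Hne Hmon Hdiam.
  set (F := fun P : H -> Prop => exists e, 0 < e /\ forall v, S e v -> P v).
  assert (HF : ProperFilter F).
  { split.
    - intros P [e [He HP]]; destruct (Hne e He) as [v Hv]; eauto.
    - split.
      + exists 1; split; [lra | easy].
      + intros P Q [e [He HP]] [e' [He' HQ]].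
        exists (Rmin e e'); split; [now apply Rmin_pos | ].
        intros v Hv; split; [apply HP | apply HQ];
          apply (Hmon (Rmin e e')); auto using Rmin_pos, Rmin_l, Rmin_r.
      + intros P Q HPQ [e [He HP]]; exists e; split; auto. }
  assert (Hc : cauchy F).
  { intros eps; destruct (Hdiam eps (cond_pos eps)) as [e [He Hd]].
    destruct (Hne e He) as [x Hx]; exists x, e; split; [exact He | ].
    intros v Hv; apply (@norm_compat1 R_AbsRing H); now apply Hd. }
  exists (lim F); intros eta Heta.
  assert (Hf := @norm_factor_gt_0 R_AbsRing H).
  assert (Hp : 0 < eta / @norm_factor R_AbsRing H) by now apply Rdiv_lt_0_compat.
  destruct (complete_cauchy F HF Hc (mkposreal _ Hp)) as [e [He Hv]].
  exists e; split; [exact He | ]; intros v HSv; specialize (Hv v HSv).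
  apply (@norm_compat2 R_AbsRing H) in Hv; simpl in Hv.
  replace eta with (@norm_factor R_AbsRing H * (eta / @norm_factor R_AbsRing H))
    by (field; lra).
  exact Hv.
Qed.

Lemma eq_of_norm_minus_le (x y : H) :
  (forall eta, 0 < eta -> norm (minus x y) <= eta) -> x = y.
Proof.
  intros Hxy.
  assert (Hn : norm (minus x y) <= 0)
    by (apply le_epsilon; intros; rewrite Rplus_0_l; auto).
  apply inner_ext; intros z.
  apply Rminus_diag_uniq; rewrite <- inner_minus_l.
  generalize (Cauchy_Schwarz (minus x y) z) (norm_ge_0 z)
    (norm_ge_0 (minus x y)); intros HC Hz H0.
  replace (norm (minus x y)) with 0 in HC by lra.
  rewrite Rmult_0_l in HC.
  generalize (Rabs_pos (inner (minus x y) z)); intros Hp.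
  destruct (Req_dec (inner (minus x y) z) 0) as [E | E]; [exact E | ].
  apply Rabs_pos_lt in E; lra.
Qed.

(** Projection theorem: x has a nearest point y in the closed subspace M, x - y is orthogonal to M,
    hence x = y. *)
Lemma subspace_full_of_trivial_orthogonal (M : H -> Prop) :
  M zero -> (forall x y, M x -> M y -> M (plus x y)) ->
  (forall (a : R) x, M x -> M (scal a x)) ->
  (forall y, (forall eps, 0 < eps -> exists m, M m /\ norm (minus m y) < eps) -> M y) ->
  (forall z, (forall y, M y -> inner y z = 0) -> z = zero) ->
  forall x, M x.
Proof.
  intros M0 Mplus Mscal Mclosed Morth x.
  (* The infimum d of the squared distances is obtained as minus the supremum of their opposites. *)
  destruct (completeness (fun r => exists y, M y /\ r = - norm (minus x y) ^ 2))
    as [d0 [Hub Hlub]].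
  { exists 0; intros r [y [_ ->]]; generalize (pow2_ge_0 (norm (minus x y))); lra. }
  { now exists (- norm (minus x zero) ^ 2), zero. }
  set (d := - d0).
  assert (Hd : forall y, M y -> d <= norm (minus x y) ^ 2).
  { intros y Hy; assert (Hy' := Hub (- norm (minus x y) ^ 2) (ex_intro _ y (conj Hy eq_refl))).
    unfold d; lra. }
  assert (Hnear : forall e, 0 < e -> exists v, M v /\ norm (minus x v) ^ 2 < d + e).
  { intros e He; apply NNPP; intros Hn.
    assert (Hb : d0 <= d0 - e); [ | lra].
    apply Hlub; intros r [y [My ->]].
    destruct (Rlt_le_dec (norm (minus x y) ^ 2) (d + e)) as [Hl | Hl].
    + now destruct Hn; exists y.
    + unfold d in Hl; lra. }
  destruct (shrinking_sets_limit (fun e v => M v /\ norm (minus x v) ^ 2 < d + e))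
    as [y Hy].
  - exact Hnear.
  - intros e e' v He Hee' [Mv Hv]; split; [exact Mv | lra].
  - intros eta Heta; exists (eta ^ 2 / 4); split; [nra | ].
    intros v w [Mv Hv] [Mw Hw].
    assert (Hm := Hd (scal (/ 2) (plus v w)) (Mscal _ _ (Mplus _ _ Mv Mw))).
    (* Parallelogram law. The midpoint of v and w lies in M, at squared distance at least d from x,
       so |v - w|^2 < 4 e = eta^2. *)
    assert (Hpar : norm (minus v w) ^ 2 = 2 * norm (minus x v) ^ 2
       + 2 * norm (minus x w) ^ 2 - 4 * norm (minus x (scal (/ 2) (plus v w))) ^ 2).
    { rewrite !norm_sqr_inner; repeat inner_expand.
      rewrite (inner_sym _ w v), (inner_sym _ v x), (inner_sym _ w x); field. }
    generalize (norm_ge_0 (minus v w)); nra.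
  - assert (My : M y).
    { apply Mclosed; intros eps Heps.
      destruct (Hy eps Heps) as [e [He Hv]].
      destruct (Hnear e He) as [v Hv'].
      exists v; split; [easy | now apply Hv]. }
    assert (Hmin : norm (minus x y) ^ 2 <= d).
    { generalize (norm_ge_0 (minus x y)); intros H0.
      apply le_epsilon; intros eps Heps.
      set (eta := Rmin 1 (eps / (4 * (2 + norm (minus x y))))).
      assert (Heta : 0 < eta).
      { apply Rmin_pos; [lra | apply Rdiv_lt_0_compat; lra]. }
      assert (Heta1 : eta <= 1) by apply Rmin_l.
      assert (Heta2 : eta * (4 * (2 + norm (minus x y))) <= eps).
      { apply Rle_trans with
          (eps / (4 * (2 + norm (minus x y))) * (4 * (2 + norm (minus x y)))).
        - apply Rmult_le_compat_r; [lra | apply Rmin_r].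
        - right; field; lra. }
      destruct (Hy eta Heta) as [e [He Hv]].
      assert (He' : 0 < Rmin e (eps / 2)) by (apply Rmin_pos; lra).
      destruct (Hnear _ He') as [v [Mv Hxv]].
      generalize (Rmin_l e (eps / 2)) (Rmin_r e (eps / 2)); intros HR1 HR2.
      assert (Hve : norm (minus x v) ^ 2 < d + e) by lra.
      specialize (Hv v (conj Mv Hve)).
      generalize (norm_minus_triangle x v y) (norm_minus_triangle x y v)
        (norm_ge_0 (minus x v)) (norm_ge_0 (minus v y)).
      rewrite (norm_minus_sym y v); intros Ht Ht' Hp1 Hp2; nra. }
    assert (Hz : minus x y = zero).
    { apply Morth; intros m Mm.
      set (a := inner m (minus x y)).
      set (q := norm m ^ 2).
      assert (Hq : 0 <= q) by apply pow2_ge_0.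
      (* The optimal step along m is a / q; q + 1 also covers m = 0 and still lowers the squared
         distance strictly unless a = 0. *)
      assert (Ht := Hd (plus y (scal (a / (q + 1)) m)) (Mplus _ _ My (Mscal _ _ Mm))).
      assert (He : norm (minus x (plus y (scal (a / (q + 1)) m))) ^ 2
        = norm (minus x y) ^ 2 - a ^ 2 * (q + 2) / (q + 1) ^ 2).
      { replace (norm (minus x (plus y (scal (a / (q + 1)) m))) ^ 2) with
          (norm (minus x y) ^ 2 - 2 * (a / (q + 1)) * a + (a / (q + 1)) ^ 2 * q).
        - field; lra.
        - unfold a at 2, q at 3; rewrite !norm_sqr_inner; repeat inner_expand.
          rewrite (inner_sym _ m x), (inner_sym _ m y); ring. }
      assert (Hle : a ^ 2 * (q + 2) / (q + 1) ^ 2 <= 0) by lra.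
      apply Rmult_le_compat_r with (r := (q + 1) ^ 2) in Hle; [ | nra].
      replace (a ^ 2 * (q + 2) / (q + 1) ^ 2 * (q + 1) ^ 2) with (a ^ 2 * (q + 2))
        in Hle by (field; lra).
      nra. }
    replace x with y; [exact My | ].
    apply inner_ext; intros z.
    apply Rminus_diag_uniq_sym; rewrite <- inner_minus_l, Hz; apply inner_zero_l.
Qed.

End Completeness.

Section LinearOperator.

Context {H : HilbertSpace} (B : operator H).
Hypothesis B_linear : linear_op B.

Lemma op_dom_zero : dom B zero.
Proof. apply B_linear. Qed.

Lemma op_dom_plus (x y : H) : dom B x -> dom B y -> dom B (plus x y).
Proof. intros; now apply B_linear. Qed.

Lemma op_plus (x y : H) : dom B x -> dom B y -> B (plus x y) = plus (B x) (B y).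
Proof. intros; now apply B_linear. Qed.

Lemma op_dom_scal (a : R) (x : H) : dom B x -> dom B (scal a x).
Proof. intros; now apply B_linear. Qed.

Lemma op_scal (a : R) (x : H) : dom B x -> B (scal a x) = scal a (B x).
Proof. intros; now apply B_linear. Qed.

Lemma minus_scal (x y : H) : minus x y = plus x (scal (-1 : R) y).
Proof. vec_ring. Qed.

Lemma op_dom_minus (x y : H) : dom B x -> dom B y -> dom B (minus x y).
Proof. intros; rewrite minus_scal; auto using op_dom_plus, op_dom_scal. Qed.

Lemma op_minus (x y : H) : dom B x -> dom B y -> B (minus x y) = minus (B x) (B y).
Proof.
  intros; rewrite !minus_scal, op_plus, op_scal; auto using op_dom_scal.
Qed.

Hypothesis B_self_adjoint : self_adjoint B.

Lemma self_adjoint_inner x y : dom B x -> dom B y -> inner (B x) y = inner x (B y).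
Proof. intros Hx Hy; now apply (proj1 (B_self_adjoint y (B y))). Qed.

Variable c : R.
Hypothesis B_bounded_below : forall v, dom B v -> norm v <= c * norm (B v).

Hypothesis c_pos : 0 < c.

(** The range is closed because the lower bound makes preimages of nearby vectors nearby, and its
    orthogonal complement is the kernel of B, which is trivial by the same bound. *)
Lemma bounded_below_surjective w : exists v, dom B v /\ B v = w.
Proof.
  apply (subspace_full_of_trivial_orthogonal (fun w => exists v, dom B v /\ B v = w)).
  - exists zero; split; [exact op_dom_zero | ].
    assert (Hz : (zero : H) = scal (0 : R) zero) by vec_ring.
    rewrite Hz at 1; rewrite op_scal by exact op_dom_zero; vec_ring.
  - intros x y [v [Dv <-]] [v' [Dv' <-]]; exists (plus v v').
    auto using op_dom_plus, op_plus.
  - intros a x [v [Dv <-]]; exists (scal a v); auto using op_dom_scal, op_scal.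
  - intros y Hy.
    destruct (shrinking_sets_limit (fun e v => dom B v /\ norm (minus (B v) y) < e))
      as [v Hv].
    + intros e He; destruct (Hy e He) as [m [[v [Dv <-]] Hm]]; eauto.
    + intros e e' v He Hee' [Dv Hv]; split; [exact Dv | lra].
    + intros eta Heta; exists (eta / (2 * c)); split.
      { apply Rdiv_lt_0_compat; lra. }
      intros v w' [Dv Hv] [Dw Hw].
      eapply Rle_lt_trans; [apply B_bounded_below; now apply op_dom_minus | ].
      rewrite op_minus by assumption.
      apply Rle_lt_trans with (c * (norm (minus (B v) y) + norm (minus (B w') y))).
      * apply Rmult_le_compat_l; [lra | ].
        rewrite (norm_minus_sym (B w') y); apply norm_minus_triangle.
      * replace eta with (c * (eta / (2 * c) + eta / (2 * c))) by (field; lra).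
        apply Rmult_lt_compat_l; lra.
    (* A self-adjoint operator is closed: it is enough to check (B x, v) = (x, y) for x in D(B), an
       identity inherited from approximants v' with v' near v and B v' near y. *)
    + exists v; apply B_self_adjoint; intros x Dx.
      apply Rminus_diag_uniq.
      set (r := inner (B x) v - inner x y).
      assert (Hr : Rabs r <= 0); [ | destruct (Req_dec r 0) as [E | E];
        [exact E | apply Rabs_pos_lt in E; lra]].
      apply le_epsilon; intros eps Heps; rewrite Rplus_0_l.
      generalize (norm_ge_0 (B x)) (norm_ge_0 x); intros HBx Hx.
      destruct (Hv (eps / (2 * (1 + norm (B x))))) as [e [He Hve]].
      { apply Rdiv_lt_0_compat; lra. }
      destruct (Hy (Rmin e (eps / (2 * (1 + norm x))))) as [m [[v' [Dv' <-]] Hm]].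
      { apply Rmin_pos; [exact He | apply Rdiv_lt_0_compat; lra]. }
      assert (Hm1 := Rlt_le_trans _ _ _ Hm (Rmin_l _ _)).
      assert (Hm2 := Rlt_le_trans _ _ _ Hm (Rmin_r _ _)).
      specialize (Hve v' (conj Dv' Hm1)).
      replace r with (inner x (minus (B v') y) - inner (B x) (minus v' v)).
      2:{ unfold r; rewrite !inner_minus_r, (self_adjoint_inner x v' Dx Dv'); ring. }
      assert (HC1 := Cauchy_Schwarz x (minus (B v') y)).
      assert (HC2 := Cauchy_Schwarz (B x) (minus v' v)).
      assert (HP1 : norm x * norm (minus (B v') y) <= eps / 2).
      { apply Rle_trans with ((1 + norm x) * (eps / (2 * (1 + norm x)))).
        - apply Rmult_le_compat; try apply norm_ge_0; lra.
        - right; field; lra. }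
      assert (HP2 : norm (B x) * norm (minus v' v) <= eps / 2).
      { apply Rle_trans with ((1 + norm (B x)) * (eps / (2 * (1 + norm (B x))))).
        - apply Rmult_le_compat; try apply norm_ge_0; lra.
        - right; field; lra. }
      unfold Rminus; eapply Rle_trans; [apply Rabs_triang | ].
      rewrite Rabs_Ropp; lra.
  - intros z Hz.
    (* Orthogonality to the range reads (B x, z) = (x, 0) for all x in D(B), which places z in the
       domain of the adjoint with image 0. *)
    assert (Hz' : dom B z /\ B z = zero).
    { apply B_self_adjoint; intros x Dx; rewrite inner_zero_r; apply Hz; eauto. }
    destruct Hz' as [Dz Bz].
    assert (Hn := B_bounded_below z Dz).
    rewrite Bz, (norm_zero_eq zero eq_refl), Rmult_0_r in Hn.
    assert (Hn0 : norm z = 0) by (apply Rle_antisym; [exact Hn | apply norm_ge_0]).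
    exact (norm_eq_zero z Hn0).
Qed.

(** The [iota] in [inv_op] is meaningful only for a unique preimage: existence is surjectivity,
    uniqueness the lower bound. *)
Lemma inv_op_spec w : dom B (inv_op B w) /\ B (inv_op B w) = w.
Proof.
  apply (iota_correct (fun v : H => dom B v /\ B v = w)).
  destruct (bounded_below_surjective w) as [v [Dv Bv]].
  exists v; split; [easy | ]; intros v' [Dv' Bv'].
  apply eq_of_norm_minus_le; intros eta Heta.
  eapply Rle_trans; [apply B_bounded_below; now apply op_dom_minus | ].
  rewrite op_minus, Bv, Bv', norm_zero_eq by (vec_ring || assumption); lra.
Qed.

Lemma inv_op_lipschitz w w' :
  norm (minus (inv_op B w) (inv_op B w')) <= c * norm (minus w w').
Proof.
  destruct (inv_op_spec w) as [Dw Bw], (inv_op_spec w') as [Dw' Bw'].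
  rewrite <- Bw at 2; rewrite <- Bw' at 2; rewrite <- op_minus by assumption.
  apply B_bounded_below; now apply op_dom_minus.
Qed.

Lemma continuous_on_inv_op a b (g : R -> H) :
  continuous_on (fun s => a <= s <= b) g ->
  continuous_on (fun s => a <= s <= b) (fun s => inv_op B (g s)).
Proof.
  intros Hg; apply (continuous_onI (V := H)); intros t Ht eps Heps.
  destruct (continuous_onE (V := H) a b g Hg t Ht (eps / c)) as [d [Hd Hs]].
  { now apply Rdiv_lt_0_compat. }
  exists d; split; [exact Hd | ]; intros s Hsab Hst.
  eapply Rle_lt_trans; [apply inv_op_lipschitz | ].
  replace eps with (c * (eps / c)) by (field; lra).
  apply Rmult_lt_compat_l; [exact c_pos | now apply Hs].
Qed.

End LinearOperator.

(** * The semigroup *)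

Section Semigroup.

Context {H : HilbertSpace}.

Lemma linear_scal_H (l : H -> H) (a : R) (x : H) :
  is_linear l -> l (scal a x) = scal a (l x).
Proof. intros Hl; exact (linear_scal l Hl a x). Qed.

Lemma linear_minus (l : H -> H) (x y : H) :
  is_linear l -> l (minus x y) = minus (l x) (l y).
Proof.
  intros Hl; rewrite !minus_scal, <- linear_scal_H by exact Hl.
  exact (linear_plus l Hl x (scal (-1 : R) y)).
Qed.

(** A bounded linear map commutes with Riemann sums and, being continuous, with their limit. *)
Lemma is_RInt_linear (l : H -> H) (g : R -> H) a b (I : H) :
  is_linear l -> is_RInt g a b I -> is_RInt (fun s => l (g s)) a b (l I).
Proof.
  intros Hl Hg.
  assert (Hsum : forall ptd, l (Riemann_sum g ptd) = Riemann_sum (fun s => l (g s)) ptd).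
  { intros ptd; induction ptd as [x | h s IH] using SF_cons_ind.
    - change (l zero = zero).
      assert (Hz : (zero : H) = scal (0 : R) zero) by vec_ring.
      rewrite Hz at 1.
      rewrite linear_scal_H by exact Hl; vec_ring.
    - rewrite !Riemann_sum_cons, <- IH.
      etransitivity; [apply (linear_plus l Hl) | f_equal].
      apply (linear_scal l Hl). }
  apply filterlim_ext with
    (fun ptd => l (scal (sign (b - a)) (Riemann_sum g ptd))).
  { intros ptd; rewrite <- Hsum; apply (linear_scal l Hl). }
  apply filterlim_comp with (1 := Hg).
  exact (linear_cont l I Hl).
Qed.

Lemma filterlim_at_rightP (g : R -> H) (l : H) :
  filterlim g (at_right 0) (locally l) <->
  forall eps, 0 < eps -> exists d, 0 < d /\
    forall h, 0 < h < d -> norm (minus (g h) l) < eps.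
Proof.
  split.
  - intros Hg eps Heps.
    destruct (proj1 (filterlim_locally_ball_norm _ _) Hg (mkposreal eps Heps)) as [d Hd].
    exists d; split; [apply cond_pos | ]; intros h Hh; apply Hd; [ | easy].
    change (Rabs (h - 0) < d); rewrite Rminus_0_r, Rabs_pos_eq; lra.
  - intros Hg.
    apply (filterlim_locally_ball_norm (U := H) (F := at_right 0) g l); intros eps.
    destruct (Hg eps (cond_pos eps)) as [d [Hd Hs]].
    exists (mkposreal d Hd); intros h Hh Hh0; apply Hs; split; [easy | ].
    change (Rabs (h - 0) < d) in Hh; rewrite Rminus_0_r, Rabs_pos_eq in Hh; lra.
Qed.

Variable E : R -> H -> H.
Hypothesis E_semigroup : C0_semigroup E.

Lemma semigroup_linear t : 0 <= t -> is_linear (E t).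
Proof. apply E_semigroup. Qed.

Lemma semigroup_zero x : E 0 x = x.
Proof. apply E_semigroup. Qed.

Lemma semigroup_plus s t x : 0 <= s -> 0 <= t -> E (s + t) x = E s (E t x).
Proof. apply E_semigroup. Qed.

Lemma semigroup_right_continuous x eps :
  0 < eps -> exists d, 0 < d /\ forall h, 0 <= h < d -> norm (minus (E h x) x) < eps.
Proof.
  intros Heps.
  destruct (proj1 (filterlim_at_rightP _ _) (proj2 (proj2 (proj2 E_semigroup)) x) eps Heps)
    as [d [Hd Hh]].
  exists d; split; [exact Hd | ]; intros h [Hh0 Hhd].
  destruct Hh0 as [Hh0 | <-]; [now apply Hh | ].
  rewrite semigroup_zero, norm_zero_eq; [exact Heps | vec_ring].
Qed.

(* If no bound held near 0, some E t with t <= 1/(n+1) would exceed n throughout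
   a small ball inside any given ball; the common point of nested such balls
   contradicts the strong continuity at 0. *)
Lemma semigroup_bounded_near_zero :
  exists d M, 0 < d /\ 1 <= M /\
    forall t (x : H), 0 <= t <= d -> norm (E t x) <= M * norm x.
Proof.
  apply NNPP; intros Hn.
  assert (Hunb : forall d M, 0 < d -> 1 <= M ->
    exists t (x : H), 0 <= t <= d /\ M * norm x < norm (E t x)).
  { intros d M Hd HM; apply NNPP; intros Hn'; apply Hn.
    exists d, M; split; [easy | split; [easy | ]]; intros t x Ht.
    apply Rnot_lt_le; intros Hlt; apply Hn'; eauto. }
  clear Hn.
  (* A pair is a ball given by centre and radius; the first inequality says that the ball q lies
     inside the ball p. *)
  assert (Hstep : forall (n : nat) (p : H * posreal), exists q : H * posreal,
    norm (minus (fst q) (fst p)) + snd q <= snd p /\ snd q <= / (INR n + 1) /\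
    exists t, 0 <= t <= / (INR n + 1) /\
      forall z, norm (minus z (fst q)) <= snd q -> INR n < norm (E t z)).
  { intros n [x r]; simpl.
    assert (Hn0 := pos_INR n); assert (Hr := cond_pos r).
    assert (Hinv : 0 < / (INR n + 1)) by (apply Rinv_0_lt_compat; lra).
    (* The factor is chosen so that v, rescaled to a vector w of norm r/2, satisfies |E t w| > 2n.
       Then E t exceeds n in norm at x or at x + w. *)
    destruct (Hunb (/ (INR n + 1)) (1 + 4 * INR n / r)) as [t [v [Ht Hv]]].
    { exact Hinv. }
    { assert (0 <= 4 * INR n / r); [ | lra].
      apply Rmult_le_pos; [lra | apply Rlt_le, Rinv_0_lt_compat, Hr]. }
    assert (HL := semigroup_linear t (proj1 Ht)).
    destruct (linear_norm _ HL) as [K [HK HKn]].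
    assert (Hv0 : 0 < norm v).
    { destruct (Req_dec (norm v) 0) as [E0 | E0].
      - specialize (HKn v); rewrite E0 in *; lra.
      - generalize (norm_ge_0 v); lra. }
    set (w := scal (r / (2 * norm v)) v).
    assert (Hw : norm w = r / 2).
    { unfold w; rewrite norm_scal_eq, Rabs_pos_eq.
      - field; lra.
      - apply Rlt_le, Rdiv_lt_0_compat; lra. }
    assert (HEw : 2 * INR n < norm (E t w)).
    { unfold w; rewrite linear_scal_H, norm_scal_eq, Rabs_pos_eq
        by (exact HL || (apply Rlt_le, Rdiv_lt_0_compat; lra)).
      apply Rlt_trans with (r / (2 * norm v) * ((1 + 4 * INR n / r) * norm v)).
      - replace (r / (2 * norm v) * ((1 + 4 * INR n / r) * norm v))
          with (r / 2 + 2 * INR n) by (field; lra).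
        lra.
      - apply Rmult_lt_compat_l; [apply Rdiv_lt_0_compat; lra | exact Hv]. }
    assert (Hy : exists y : H, norm (minus y x) <= r / 2 /\ INR n < norm (E t y)).
    { destruct (Rlt_le_dec (INR n) (norm (E t x))) as [Hx | Hx].
      - exists x; split; [rewrite norm_zero_eq; [lra | vec_ring] | exact Hx].
      - exists (plus x w); split.
        + replace (minus (plus x w) x) with w by vec_ring; lra.
        + replace w with (minus (plus x w) x) in HEw by vec_ring.
          rewrite linear_minus in HEw by exact HL.
          assert (Ht' := norm_minus_le (E t (plus x w)) (E t x)); lra. }
    destruct Hy as [y [Hyx Hny]].
    (* The three bounds give nesting, radii tending to 0, and, as E t is K-Lipschitz, a loss of at
       most half of |E t y| - n over the new ball. *)
    set (r' := Rmin (r / 2) (Rmin (/ (INR n + 1)) ((norm (E t y) - INR n) / (2 * K)))).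
    assert (Hr' : 0 < r').
    { repeat apply Rmin_pos; try lra; apply Rdiv_lt_0_compat; lra. }
    assert (Hr1 : r' <= r / 2) by apply Rmin_l.
    assert (Hr2 : r' <= / (INR n + 1))
      by (eapply Rle_trans; [apply Rmin_r | apply Rmin_l]).
    assert (Hr3 : r' <= (norm (E t y) - INR n) / (2 * K))
      by (eapply Rle_trans; [apply Rmin_r | apply Rmin_r]).
    exists (y, mkposreal r' Hr'); simpl.
    split; [lra | split; [exact Hr2 | exists t; split; [exact Ht | ]]].
    intros z Hz.
    assert (Hd : norm (minus (E t y) (E t z)) <= K * norm (minus z y)).
    { rewrite (norm_minus_sym z y), <- linear_minus by exact HL; apply HKn. }
    assert (Hd2 : K * norm (minus z y) <= (norm (E t y) - INR n) / 2).
    { apply Rle_trans with (K * ((norm (E t y) - INR n) / (2 * K))).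
      - apply Rmult_le_compat_l; lra.
      - right; field; lra. }
    assert (Hinv' := @norm_triangle R_AbsRing H (E t z) (minus (E t y) (E t z))).
    assert (Hs : plus (E t z) (minus (E t y) (E t z)) = E t y) by vec_ring.
    assert (Hn' : norm (E t y) <= norm (E t z) + norm (minus (E t y) (E t z)))
      by (rewrite <- Hs at 1; exact Hinv').
    lra. }
  clear Hunb.
  set (next := fun n p => proj1_sig (constructive_indefinite_description _ (Hstep n p))).
  assert (Hnext := fun n p => proj2_sig (constructive_indefinite_description _ (Hstep n p))).
  set (c := fix c (n : nat) : H * posreal :=
    match n with O => (zero, mkposreal 1 Rlt_0_1) | S m => next m (c m) end).
  assert (Hc : forall n, norm (minus (fst (c (S n))) (fst (c n))) + snd (c (S n)) <= snd (c n)
    /\ snd (c (S n)) <= / (INR n + 1) /\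
    exists t, 0 <= t <= / (INR n + 1) /\
      forall z, norm (minus z (fst (c (S n)))) <= snd (c (S n)) -> INR n < norm (E t z)).
  { intros n; exact (Hnext n (c n)). }
  assert (Hnest : forall n k,
    norm (minus (fst (c (k + n)%nat)) (fst (c n))) + snd (c (k + n)%nat) <= snd (c n)).
  { intros n k; induction k as [ | k IH].
    - simpl; rewrite norm_zero_eq; [lra | vec_ring].
    - destruct (Hc (k + n)%nat) as [H1 _].
      assert (H2 := norm_minus_triangle (fst (c (S (k + n)))) (fst (c (k + n)%nat)) (fst (c n))).
      change (S k + n)%nat with (S (k + n)); lra. }
  assert (Hsmall : forall e n, 0 < e -> exists k, snd (c (k + n)%nat) < e).
  { intros e n He.
    destruct (INR_unbounded (/ e)) as [N HN].
    exists (S N); destruct (Hc N) as [_ [H1 _]].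
    assert (H2 := Hnest (S N) n).
    generalize (norm_ge_0 (minus (fst (c (n + S N)%nat)) (fst (c (S N))))); intros H3.
    assert (Hie : 0 < / e) by now apply Rinv_0_lt_compat.
    assert (H4 : / (INR N + 1) < e).
    { rewrite <- (Rinv_inv e); apply Rinv_lt_contravar; [apply Rmult_lt_0_compat | ]; lra. }
    rewrite Nat.add_comm; lra. }
  (* Centres are indexed by the size of their radius rather than by n: nesting then bounds the
     distance of two centres by the larger radius. *)
  destruct (shrinking_sets_limit (fun e v => exists n, v = fst (c n) /\ snd (c n) < e))
    as [y Hy].
  - intros e He; destruct (Hsmall e 0%nat He) as [k Hk]; eauto.
  - intros e e' v He Hee' [n [-> Hn]]; exists n; split; [easy | lra].
  - intros eta Heta; exists eta; split; [exact Heta | ].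
    assert (Hle : forall n m, (n <= m)%nat -> snd (c n) < eta ->
      norm (minus (fst (c m)) (fst (c n))) < eta).
    { intros n m Hnm Hn; specialize (Hnest n (m - n)%nat).
      replace (m - n + n)%nat with m in Hnest by lia.
      generalize (cond_pos (snd (c m))); lra. }
    intros v w [n [-> Hn]] [m [-> Hm]].
    destruct (Nat.le_ge_cases n m); [rewrite norm_minus_sym | ]; auto.
  - assert (Hin : forall n, norm (minus y (fst (c n))) <= snd (c n)).
    { intros n; apply le_epsilon; intros eps Heps.
      destruct (Hy eps Heps) as [e [He Hv]].
      destruct (Hsmall e n He) as [k Hk].
      assert (H1 : norm (minus (fst (c (k + n)%nat)) y) < eps) by (apply Hv; eauto).
      rewrite norm_minus_sym in H1.
      assert (H2 := norm_minus_triangle y (fst (c (k + n)%nat)) (fst (c n))).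
      specialize (Hnest n k); generalize (cond_pos (snd (c (k + n)%nat))); lra. }
    (* Strong continuity gives |E t y| < |y| + 1 for t < d, while y lies in all the balls, so that
       some t <= 1/(n+1) < d has |E t y| > n > |y| + 1. *)
    destruct (semigroup_right_continuous y 1 Rlt_0_1) as [d [Hd Hcont]].
    assert (Hid : 0 < / d) by now apply Rinv_0_lt_compat.
    destruct (INR_unbounded (norm y + 1 + / d)) as [n Hn].
    generalize (norm_ge_0 y); intros Hy0.
    destruct (Hc n) as [_ [_ [t [Ht Hlarge]]]].
    specialize (Hlarge y (Hin (S n))).
    assert (Hnd : / (INR n + 1) < d).
    { rewrite <- (Rinv_inv d); apply Rinv_lt_contravar; [apply Rmult_lt_0_compat | ]; lra. }
    specialize (Hcont t ltac:(lra)).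
    assert (Hs : plus (minus (E t y) y) y = E t y) by vec_ring.
    assert (Hn' : norm (E t y) <= norm (minus (E t y) y) + norm y)
      by (rewrite <- Hs at 1; apply (@norm_triangle R_AbsRing H)).
    lra.
Qed.

(** Each further time step of length d costs a factor M, by the semigroup law. *)
Lemma semigroup_bounded b :
  exists K, 1 <= K /\ forall t (x : H), 0 <= t <= b -> norm (E t x) <= K * norm x.
Proof.
  destruct semigroup_bounded_near_zero as [d [M [Hd [HM Hnear]]]].
  assert (Hind : forall n, exists K, 1 <= K /\
    forall t (x : H), 0 <= t <= INR n * d -> norm (E t x) <= K * norm x).
  { intros n; induction n as [ | n [K [HK IH]]].
    - exists 1; split; [lra | ]; intros t x Ht; simpl in Ht.
      replace t with 0 by lra; rewrite semigroup_zero; lra.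
    - exists (M * K); split; [nra | ]; intros t x Ht; rewrite S_INR in Ht.
      generalize (norm_ge_0 x); intros Hx.
      destruct (Rle_lt_dec t d) as [Htd | Htd].
      + apply Rle_trans with (M * norm x); [apply Hnear; lra | ].
        apply Rmult_le_compat_r; nra.
      + replace t with (d + (t - d)) by ring.
        rewrite semigroup_plus by lra.
        eapply Rle_trans; [apply Hnear; lra | ].
        rewrite Rmult_assoc; apply Rmult_le_compat_l; [lra | apply IH; lra]. }
  destruct (INR_unbounded (b / d)) as [n Hn].
  destruct (Hind n) as [K [HK HKn]].
  exists K; split; [exact HK | ]; intros t x Ht; apply HKn; split; [easy | ].
  apply Rle_trans with (b / d * d); [replace (b / d * d) with b by (field; lra); lra | ].
  apply Rmult_le_compat_r; lra.
Qed.

(* Rabs only serves to get a continuous extension to the whole line. *)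
Lemma semigroup_continuous x t : continuous (fun s => E (Rabs s) x) t.
Proof.
  apply (filterlim_locally_ball_norm (U := H) (F := locally t)
           (fun s => E (Rabs s) x) (E (Rabs t) x)); intros eps.
  destruct (semigroup_bounded (Rabs t + 1)) as [K [HK HKn]].
  destruct (semigroup_right_continuous x (eps / K)) as [d [Hd Hcont]].
  { apply Rdiv_lt_0_compat; [apply cond_pos | lra]. }
  assert (Hd' : 0 < Rmin 1 d) by (apply Rmin_pos; lra).
  (* For p <= q, E q x - E p x = E p (E (q - p) x - x). The bound on E p, uniform in p, is what
     yields continuity from the left as well. *)
  assert (Hpq : forall p q, 0 <= p <= Rabs t + 1 -> p <= q < p + d ->
    norm (minus (E q x) (E p x)) < eps).
  { intros p q Hp Hq.
    replace q with (p + (q - p)) by ring.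
    rewrite semigroup_plus by lra.
    rewrite <- linear_minus by (apply semigroup_linear; lra).
    apply Rle_lt_trans with (K * norm (minus (E (q - p) x) x)); [now apply HKn | ].
    replace (pos eps) with (K * (eps / K)) by (field; lra).
    apply Rmult_lt_compat_l; [lra | apply Hcont; lra]. }
  exists (mkposreal _ Hd'); intros s Hs.
  change (Rabs (s - t) < Rmin 1 d) in Hs.
  change (norm (minus (E (Rabs s) x) (E (Rabs t) x)) < eps).
  assert (H1 := Rlt_le_trans _ _ _ Hs (Rmin_l _ _)).
  assert (H2 := Rlt_le_trans _ _ _ Hs (Rmin_r _ _)).
  assert (H3 := Rabs_triang_inv2 s t).
  generalize (Rabs_pos s) (Rabs_pos t); intros H4 H5.
  assert (H6 : Rabs (Rabs s - Rabs t) < d) by lra.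
  assert (H7 : Rabs (Rabs s - Rabs t) < 1) by lra.
  apply Rabs_def2 in H6; apply Rabs_def2 in H7.
  destruct (Rle_lt_dec (Rabs t) (Rabs s)).
  - apply Hpq; lra.
  - rewrite norm_minus_sym; apply Hpq; lra.
Qed.

Lemma semigroup_ex_RInt x a b : ex_RInt (fun s => E (Rabs s) x) a b.
Proof.
  apply (ex_RInt_continuous (V := H)); intros; apply semigroup_continuous.
Qed.

Lemma semigroup_is_RInt x a b :
  is_RInt (fun s => E (Rabs s) x) a b (RInt (fun s => E (Rabs s) x) a b).
Proof. apply (RInt_correct (V := H)), semigroup_ex_RInt. Qed.

(** Substitution s = (1 - tau) k. It reverses the orientation, whence the integral from k to 0 and
    the factor -1/k in the proof. *)
Lemma phi1_RInt k x :
  0 < k -> scal k (phi1 E k x) = RInt (fun s => E (Rabs s) x) 0 k.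
Proof.
  intros Hk.
  set (g := fun s => E (Rabs s) x).
  assert (Hg : is_RInt g k 0 (opp (RInt g 0 k))).
  { apply (is_RInt_swap (V := H)), semigroup_is_RInt. }
  assert (Hp : phi1 E k x = scal (- / k : R) (opp (RInt g 0 k))).
  { apply (is_RInt_unique (V := H)).
    apply (is_RInt_ext (V := H)) with
      (fun tau => scal (- / k : R) (scal (- k : R) (g (- k * tau + k)))).
    - rewrite Rmin_left, Rmax_right by lra; intros tau Htau.
      unfold g; replace (- k * tau + k) with ((1 - tau) * k) by ring.
      rewrite Rabs_pos_eq by nra.
      vec_simpl; field; lra.
    - apply (is_RInt_scal (V := H)).
      apply (is_RInt_comp_lin (V := H) g (- k) k).
      replace (- k * 0 + k) with k by ring; replace (- k * 1 + k) with 0 by ring.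
      exact Hg. }
  rewrite Hp; vec_simpl; field; lra.
Qed.

Lemma semigroup_RInt_shift h k x :
  0 <= h -> 0 <= k ->
  E h (RInt (fun s => E (Rabs s) x) 0 k) = RInt (fun s => E (Rabs s) x) h (k + h).
Proof.
  intros Hh Hk; symmetry.
  set (g := fun s => E (Rabs s) x).
  assert (Hs := is_RInt_comp_lin (V := H) g 1 h 0 k _
    (semigroup_is_RInt x (1 * 0 + h) (1 * k + h))).
  fold g in Hs; replace (1 * 0 + h) with h in Hs by ring.
  replace (1 * k + h) with (k + h) in Hs by ring.
  rewrite <- (is_RInt_unique (V := H) _ _ _ _ Hs).
  apply (is_RInt_unique (V := H)).
  apply (is_RInt_ext (V := H)) with (fun s => E h (g s)).
  - rewrite Rmin_left, Rmax_right by assumption; intros s Hs'.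
    unfold g; rewrite <- semigroup_plus by (try apply Rabs_pos; assumption).
    rewrite !Rabs_pos_eq by lra.
    replace (1 * s + h) with (h + s) by ring; vec_ring.
  - apply is_RInt_linear; [now apply semigroup_linear | apply semigroup_is_RInt].
Qed.

(** With G the primitive of the orbit, E h (G k) - G k = (G (k + h) - G k) - (G h - G 0), so the
    quotient tends to G' k - G' 0 = E k x - x. *)
Lemma semigroup_RInt_right_derivative k x :
  0 <= k ->
  filterlim (fun h => scal (/ h) (minus (E h (RInt (fun s => E (Rabs s) x) 0 k))
      (RInt (fun s => E (Rabs s) x) 0 k))) (at_right 0) (locally (minus (E k x) x)).
Proof.
  intros Hk.
  set (g := fun s => E (Rabs s) x).
  set (G := (fun t => RInt g 0 t) : R -> H).
  assert (Hex := semigroup_ex_RInt x : forall a b, ex_RInt g a b).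
  assert (HG : forall t, is_derive G t (g t)).
  { intros t; apply (is_derive_RInt (V := H)) with (a := 0).
    - apply filter_forall; intros s; apply semigroup_is_RInt.
    - apply semigroup_continuous. }
  apply filterlim_at_rightP; intros eps Heps.
  destruct (proj1 (has_derivP 0 (k + 1) G k (g k))
    (has_deriv_of_is_derive (V := H) _ _ _ _ _ (HG k)) (eps / 3) ltac:(lra))
    as [d1 [Hd1 H1]].
  destruct (proj1 (has_derivP 0 (k + 1) G 0 (g 0))
    (has_deriv_of_is_derive (V := H) _ _ _ _ _ (HG 0)) (eps / 3) ltac:(lra))
    as [d2 [Hd2 H2]].
  exists (Rmin 1 (Rmin d1 d2)); split; [repeat apply Rmin_pos; lra | ].
  intros h [Hh0 Hh].
  assert (Ha := Rlt_le_trans _ _ _ Hh (Rmin_l _ _)).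
  assert (Hb := Rlt_le_trans _ _ _ Hh (Rmin_r _ _)).
  assert (Hb1 := Rlt_le_trans _ _ _ Hb (Rmin_l _ _)).
  assert (Hb2 := Rlt_le_trans _ _ _ Hb (Rmin_r _ _)).
  specialize (H1 (k + h) ltac:(lra)); specialize (H2 h ltac:(lra)).
  replace (k + h - k) with h in H1 by ring; rewrite Rminus_0_r in H2.
  rewrite Rabs_pos_eq in H1, H2 by lra.
  specialize (H1 Hb1); specialize (H2 Hb2).
  assert (Hsh : E h (G k) = RInt g h (k + h)) by (apply semigroup_RInt_shift; lra).
  change (RInt g 0 k) with (G k); rewrite Hsh.
  assert (Hch : RInt g h (k + h) = minus (G (k + h)) (G h)).
  { assert (Hc : plus (G h) (RInt g h (k + h)) = G (k + h))
      by exact (RInt_Chasles (V := H) g 0 h (k + h) (Hex _ _) (Hex _ _)).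
    rewrite <- Hc; vec_ring. }
  assert (HG0 : G 0 = zero) by exact (RInt_point 0 g).
  assert (Hg0 : g 0 = x) by (unfold g; rewrite Rabs_R0; apply semigroup_zero).
  assert (Hgk : g k = E k x) by (unfold g; now rewrite Rabs_pos_eq).
  rewrite Hch.
  assert (Hv : forall v : H,
    v = scal (/ h : R) (minus (minus (minus (G (k + h)) (G k)) (scal h (g k)))
                          (minus (minus (G h) (G 0)) (scal h (g 0)))) ->
    norm v < eps).
  { intros v ->.
    rewrite norm_scal_eq, Rabs_pos_eq by (apply Rlt_le, Rinv_0_lt_compat; lra).
    apply Rmult_lt_reg_l with h; [exact Hh0 | ].
    rewrite <- Rmult_assoc, Rinv_r, Rmult_1_l by lra.
    eapply Rle_lt_trans; [apply norm_minus_le | nra]. }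
  apply Hv; rewrite HG0, Hg0, Hgk; vec_simpl; field; lra.
Qed.

Variable A : operator H.
Hypothesis E_exp : exp_minus A E.

(** E t commutes with the difference quotients at x and is bounded, so the quotients at E t x
    converge too; the generator having exactly the domain D(A), this convergence is membership. *)
Lemma semigroup_dom t x : 0 <= t -> dom A x -> dom A (E t x).
Proof.
  intros Ht Dx; apply (proj2 E_exp (E t x) (E t (A x))).
  assert (HL := semigroup_linear t Ht).
  destruct (linear_norm _ HL) as [K [HK HKn]].
  assert (Hx := proj1 (proj2 E_exp x (A x)) (conj Dx eq_refl)).
  apply filterlim_at_rightP; intros eps Heps.
  destruct (proj1 (filterlim_at_rightP _ _) Hx (eps / K)) as [d [Hd Hh]].
  { now apply Rdiv_lt_0_compat. }
  exists d; split; [exact Hd | ]; intros h Hhd.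
  assert (Hv : forall v : H,
    v = E t (minus (scal (/ h : R) (minus (E h x) x)) (opp (A x))) -> norm v < eps).
  { intros v ->; eapply Rle_lt_trans; [apply HKn | ].
    replace eps with (K * (eps / K)) by (field; lra).
    apply Rmult_lt_compat_l; [exact HK | now apply Hh]. }
  apply Hv; rewrite (linear_minus (E t)) by exact HL; f_equal.
  - rewrite (linear_scal_H (E t)), (linear_minus (E t)) by exact HL.
    now rewrite <- !semigroup_plus, Rplus_comm by lra.
  - replace (opp (A x)) with (scal (-1 : R) (A x)) by vec_ring.
    rewrite (linear_scal_H (E t)) by exact HL; vec_ring.
Qed.

(** Time averaging smooths: it sends all of H into D(A), as required for the values of f, which are
    merely in H. *)
Lemma phi1_dom k x : 0 < k -> dom A (scal k (phi1 E k x)).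
Proof.
  intros Hk; rewrite phi1_RInt by exact Hk.
  apply (proj2 E_exp _ (opp (minus (E k x) x))).
  replace (opp (opp (minus (E k x) x))) with (minus (E k x) x) by vec_ring.
  apply semigroup_RInt_right_derivative; lra.
Qed.

End Semigroup.

(** * Energy estimates *)

Section EnergyEstimate.

Context {H : HilbertSpace} (A B : operator H) (lam : R).
Hypothesis A_linear : linear_op A.
Hypothesis B_sqrt : is_sqrt_op A B.
Hypothesis lam_pos : 0 < lam.
Hypothesis poincare :
  forall v, dom B v -> norm v <= / sqrt lam * energy_norm B v.

Let B_linear : linear_op B.
Proof. exact (proj1 B_sqrt). Qed.

Let B_self_adjoint : self_adjoint B.
Proof. exact (proj1 (proj2 (proj2 B_sqrt))). Qed.

Lemma sqrt_op_dom v : dom A v -> dom B v.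
Proof.
  intros Dv; destruct (proj2 B_sqrt) as [_ [_ [_ [HD _]]]]; now apply HD.
Qed.

Lemma sqrt_op_norm_sqr v : dom A v -> norm (B v) ^ 2 = inner (A v) v.
Proof.
  intros Dv.
  destruct (proj2 B_sqrt) as [_ [_ [_ [HD Happ]]]].
  destruct (proj1 (HD v) Dv) as [D1 D2].
  rewrite (Happ v Dv), norm_sqr_inner.
  symmetry; now apply (self_adjoint_inner B B_self_adjoint).
Qed.

Lemma poincare_sqr v : dom B v -> lam * norm v ^ 2 <= norm (B v) ^ 2.
Proof.
  intros Dv; assert (Hp := poincare v Dv); unfold energy_norm in Hp.
  assert (Hs : 0 < sqrt lam) by now apply sqrt_lt_R0.
  assert (Hm : sqrt lam * norm v <= norm (B v)).
  { apply Rle_trans with (sqrt lam * (/ sqrt lam * norm (B v))).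
    - apply Rmult_le_compat_l; [lra | exact Hp].
    - right; field; lra. }
  rewrite <- (sqrt_sqrt lam) by lra.
  generalize (norm_ge_0 v) (norm_ge_0 (B v)); intros H1 H2.
  replace (sqrt lam * sqrt lam * norm v ^ 2) with ((sqrt lam * norm v) ^ 2) by ring.
  apply pow_incr; split; [apply Rmult_le_pos; lra | exact Hm].
Qed.

Lemma inv_sqrt_pos : 0 < / sqrt lam.
Proof. now apply Rinv_0_lt_compat, sqrt_lt_R0. Qed.

(* |B(v - w)|^2 = (A(v - w), v - w): boundedness of A v turns continuity of v
   into continuity of B v. *)
Lemma continuous_on_sqrt_op a b (v : R -> H) M :
  (forall s, a <= s <= b -> dom A (v s) /\ norm (A (v s)) <= M) ->
  continuous_on (fun s => a <= s <= b) v ->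
  continuous_on (fun s => a <= s <= b) (fun s => B (v s)).
Proof.
  intros HA Hv; apply (continuous_onI (V := H)); intros t Ht eps Heps.
  destruct (HA t Ht) as [Dt At].
  assert (HM : 0 <= M) by exact (Rle_trans _ _ _ (norm_ge_0 _) At).
  (* Makes 2 M |v s - v t| < eps^2; 1 + M keeps the denominator positive when M = 0. *)
  assert (He : 0 < eps ^ 2 / (2 * (1 + M))) by (apply Rdiv_lt_0_compat; nra).
  destruct (continuous_onE (V := H) a b v Hv t Ht _ He) as [d [Hd Hs]].
  exists d; split; [exact Hd | ]; intros s Hsab Hst; specialize (Hs s Hsab Hst).
  destruct (HA s Hsab) as [Ds As].
  assert (Dst : dom A (minus (v s) (v t))) by now apply op_dom_minus.
  change (norm (minus (B (v s)) (B (v t))) < eps).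
  rewrite <- (op_minus B B_linear) by now apply sqrt_op_dom.
  assert (Hn : norm (minus (A (v s)) (A (v t))) <= 2 * M)
    by (eapply Rle_trans; [apply norm_minus_le | lra]).
  assert (Hq : norm (B (minus (v s) (v t))) ^ 2 < eps ^ 2).
  { rewrite sqrt_op_norm_sqr, (op_minus A A_linear) by assumption.
    eapply Rle_lt_trans; [apply inner_le | ].
    apply Rle_lt_trans with (2 * M * norm (minus (v s) (v t))).
    - apply Rmult_le_compat_r; [apply norm_ge_0 | exact Hn].
    - apply Rle_lt_trans with (2 * (1 + M) * norm (minus (v s) (v t))).
      + apply Rmult_le_compat_r; [apply norm_ge_0 | lra].
      + replace (eps ^ 2) with (2 * (1 + M) * (eps ^ 2 / (2 * (1 + M))))
          by (field; lra).
        apply Rmult_lt_compat_l; [lra | exact Hs]. }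
  apply Rnot_le_lt; intros Hle; assert (Hp := pow_incr eps _ 2 ltac:(split; [lra | exact Hle])).
  lra.
Qed.

(* Testing the equation for w = u(. + h) - u with w gives
   (|w|^2)' <= 2 (L h |w| - lam |w|^2) <= L^2 h^2 / (2 lam); dividing by h^2,
   the difference quotients of u are bounded. *)
Lemma solution_derivative_bounded (T L : R) (f u u' : R -> H) :
  0 < T ->
  (forall t, 0 <= t <= T -> has_deriv 0 T u t (u' t)) ->
  (forall t, 0 <= t <= T -> dom A (u t) /\ plus (u' t) (A (u t)) = f t) ->
  (forall s t, 0 <= s -> s <= t -> t <= T -> norm (minus (f t) (f s)) <= L * (t - s)) ->
  exists C, forall t, 0 <= t <= T -> norm (u' t) <= C.
Proof.
  intros HT Hu Heq HL.
  set (K := L ^ 2 * T / (2 * lam)).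
  assert (HK : 0 <= K).
  { unfold K; apply Rmult_le_pos; [nra | ].
    apply Rlt_le, Rinv_0_lt_compat; lra. }
  assert (Hdiff : forall h t, 0 < h -> 0 <= t -> t + h <= T ->
    norm (minus (u (t + h)) (u t)) ^ 2 <= norm (minus (u h) (u 0)) ^ 2 + h ^ 2 * K).
  { intros h t Hh Ht Hth.
    set (w := fun s => minus (u (s + h)) (u s)).
    (* The maximum over n of 2 (L h n - lam n^2), attained where L h = 2 lam n. Over a time at most
       T it accumulates to c T = h^2 K. *)
    set (c := L ^ 2 * h ^ 2 / (2 * lam)).
    assert (Hmono : norm (w t) ^ 2 + - c * t <= norm (w 0) ^ 2 + - c * 0).
    { apply (has_deriv_nonpos_le 0 t (fun s => norm (w s) ^ 2 + - c * s)
        (fun s => 2 * inner (minus (u' (s + h)) (u' s)) (w s) + - c)); [exact Ht | | ].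
      - intros s Hs; apply has_deriv_plus_real.
        + apply has_deriv_norm_sqr, has_deriv_minus.
          * apply (has_deriv_shift 0 T); try lra; apply Hu; lra.
          * apply (has_deriv_sub 0 T); try lra; apply Hu; lra.
        + apply (has_deriv_of_is_derive (V := R_NormedModule)).
          auto_derive; [easy | ring].
      - intros s Hs.
        destruct (Heq s ltac:(lra)) as [Ds Es].
        destruct (Heq (s + h) ltac:(lra)) as [Dh Eh].
        assert (Hf := HL s (s + h) ltac:(lra) ltac:(lra) ltac:(lra)).
        replace (s + h - s) with h in Hf by ring.
        assert (Dw : dom A (w s)) by now apply op_dom_minus.
        assert (Hw : inner (minus (u' (s + h)) (u' s)) (w s)
          = inner (minus (f (s + h)) (f s)) (w s) - norm (B (w s)) ^ 2).
        { rewrite (sqrt_op_norm_sqr _ Dw).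
          assert (Aw : A (w s) = minus (A (u (s + h))) (A (u s)))
            by now apply op_minus.
          rewrite Aw, <- Es, <- Eh; repeat inner_expand; ring. }
        rewrite Hw.
        assert (HP := poincare_sqr (w s) (sqrt_op_dom _ Dw)).
        assert (HC := inner_le (minus (f (s + h)) (f s)) (w s)).
        set (n := norm (w s)) in *.
        assert (Hn : 0 <= n) by apply norm_ge_0.
        assert (HC' : inner (minus (f (s + h)) (f s)) (w s) <= L * h * n).
        { eapply Rle_trans; [exact HC | ]; now apply Rmult_le_compat_r. }
        assert (Hsq : 2 * (L * h * n - lam * n ^ 2) <= c).
        { unfold c; apply Rmult_le_reg_r with (2 * lam); [lra | ].
          replace (L ^ 2 * h ^ 2 / (2 * lam) * (2 * lam)) with (L ^ 2 * h ^ 2)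
            by (field; lra).
          generalize (pow2_ge_0 (L * h - 2 * lam * n)); nra. }
        lra. }
    unfold w in Hmono; rewrite Rplus_0_l in Hmono.
    assert (Hct : c * t <= h ^ 2 * K).
    { replace (h ^ 2 * K) with (c * T) by (unfold c, K; field; lra).
      apply Rmult_le_compat_l; [ | lra].
      unfold c; apply Rmult_le_pos; [nra | apply Rlt_le, Rinv_0_lt_compat; lra]. }
    lra. }
  (* Differentiability at 0 bounds the initial increment |u h - u 0| by (|u' 0| + 1) h, the starting
     value for [Hdiff]. *)
  destruct (proj1 (has_derivP 0 T u 0 (u' 0)) (Hu 0 ltac:(lra)) 1 Rlt_0_1)
    as [d [Hd H0]].
  set (C0 := sqrt ((norm (u' 0) + 1) ^ 2 + K)).
  assert (HC0 : C0 ^ 2 = (norm (u' 0) + 1) ^ 2 + K).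
  { unfold C0; rewrite pow2_sqrt; [easy | ].
    generalize (pow2_ge_0 (norm (u' 0) + 1)); lra. }
  assert (HC0p : 0 <= C0) by apply sqrt_pos.
  assert (Hlip : forall h t, 0 < h < d -> 0 <= t -> t + h <= T ->
    norm (minus (u (t + h)) (u t)) <= C0 * h).
  { intros h t Hh Ht Hth.
    specialize (H0 h ltac:(lra)); rewrite Rminus_0_r, Rabs_pos_eq in H0 by lra.
    specialize (H0 ltac:(lra)).
    assert (Hn : norm (minus (u h) (u 0)) <= (norm (u' 0) + 1) * h).
    { assert (Hs : minus (u h) (u 0)
        = plus (minus (minus (u h) (u 0)) (scal h (u' 0))) (scal h (u' 0))) by vec_ring.
      rewrite Hs; eapply Rle_trans; [apply (@norm_triangle R_AbsRing H) | ].
      rewrite norm_scal_eq, Rabs_pos_eq; lra. }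
    specialize (Hdiff h t ltac:(lra) Ht Hth).
    assert (Hn2 := pow_incr _ _ 2 (conj (norm_ge_0 (minus (u h) (u 0))) Hn)).
    apply Rnot_lt_le; intros Hlt.
    assert (Hch : 0 <= C0 * h) by nra.
    assert (Hlt2 : (C0 * h) ^ 2 < norm (minus (u (t + h)) (u t)) ^ 2) by nra.
    rewrite Rpow_mult_distr, HC0 in Hlt2; nra. }
  exists (C0 + 1); intros t Ht.
  destruct (proj1 (has_derivP 0 T u t (u' t)) (Hu t Ht) 1 Rlt_0_1) as [d' [Hd' Ht']].
  (* h <= T/2 ensures that t + h or t - h lies in [0,T]; h < d allows [Hlip], and h < d' the
     estimate of the derivative at t. *)
  set (h := Rmin T (Rmin d d') / 2).
  assert (Hm : 0 < Rmin T (Rmin d d')) by (repeat apply Rmin_pos; lra).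
  assert (Hm1 : Rmin T (Rmin d d') <= T) by apply Rmin_l.
  assert (Hm2 : Rmin T (Rmin d d') <= d)
    by (eapply Rle_trans; [apply Rmin_r | apply Rmin_l]).
  assert (Hm3 : Rmin T (Rmin d d') <= d')
    by (eapply Rle_trans; [apply Rmin_r | apply Rmin_r]).
  assert (Hh : 0 < h) by (unfold h; lra).
  assert (Hex : exists s, 0 <= s <= T /\ Rabs (s - t) = h /\
    norm (minus (u s) (u t)) <= C0 * h).
  { destruct (Rle_lt_dec (t + h) T) as [Hth | Hth].
    - exists (t + h); split; [lra | split].
      + replace (t + h - t) with h by ring; apply Rabs_pos_eq; lra.
      + apply Hlip; unfold h in *; lra.
    - exists (t - h); split; [unfold h in *; lra | split].
      + replace (t - h - t) with (- h) by ring; rewrite Rabs_Ropp; apply Rabs_pos_eq; lra.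
      + rewrite norm_minus_sym.
        assert (Hl := Hlip h (t - h) ltac:(unfold h in *; lra) ltac:(unfold h in *; lra) ltac:(lra)).
        now replace (t - h + h) with t in Hl by ring. }
  destruct Hex as [s [Hs [Hst Hl]]].
  specialize (Ht' s Hs ltac:(rewrite Hst; unfold h; lra)); rewrite Hst in Ht'.
  assert (Hsc : scal (s - t) (u' t) = minus (minus (u s) (u t))
    (minus (minus (u s) (u t)) (scal (s - t) (u' t)))) by vec_ring.
  apply Rmult_le_reg_l with h; [exact Hh | ].
  rewrite <- Hst at 1; rewrite <- norm_scal_eq, Hsc.
  eapply Rle_trans; [apply norm_minus_le | lra].
Qed.

(** The estimate on one cell, for an arbitrary affine v with coefficients in D(A). The bound M on A
    u provides the continuity of A^(1/2) e. *)
Lemma energy_inequality a b (p q : H) (f u u' : R -> H) M :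
  (forall t, a <= t <= b -> has_deriv a b u t (u' t)) ->
  (forall t, a <= t <= b -> dom A (u t) /\ plus (u' t) (A (u t)) = f t) ->
  (forall t, a <= t <= b -> norm (A (u t)) <= M) ->
  continuous_on (fun s => a <= s <= b) f ->
  dom A p -> dom A q ->
  let v := fun s => plus p (scal (s - a) q) in
  let r := fun s => minus (plus q (A (v s))) (f s) in
  let e := fun s => minus (u s) (v s) in
  forall t, a <= t <= b ->
    ex_RInt (fun s => energy_norm B (e s) ^ 2) a t /\
    ex_RInt (fun s => dual_norm B (r s) ^ 2) a t /\
    norm (e t) ^ 2 + RInt (fun s => energy_norm B (e s) ^ 2) a t
      <= norm (e a) ^ 2 + RInt (fun s => dual_norm B (r s) ^ 2) a t.
Proof.
  intros Hu Heq HM Hf Dp Dq v r e t Ht.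
  assert (Dv : forall s, dom A (v s)) by (intros; unfold v; auto using op_dom_plus, op_dom_scal).
  assert (Av : forall s, A (v s) = plus (A p) (scal (s - a) (A q))).
  { intros s; unfold v; rewrite op_plus, op_scal; auto using op_dom_scal. }
  assert (De : forall s, a <= s <= b -> dom A (e s)).
  { intros s Hs; apply op_dom_minus; [easy | now apply Heq | apply Dv]. }
  assert (Ae : forall s, a <= s <= b -> A (e s) = minus (A (u s)) (A (v s))).
  { intros s Hs; apply op_minus; [easy | now apply Heq | apply Dv]. }
  assert (He : forall s, a <= s <= b -> has_deriv a b e s (minus (u' s) q)).
  { intros s Hs; apply has_deriv_minus; [now apply Hu | apply has_deriv_affine]. }
  assert (Ce : continuous_on (fun s => a <= s <= b) (fun s => energy_norm B (e s) ^ 2)).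
  { apply (continuous_on_norm_sqr (V := H) a b (fun s => B (e s))).
    apply continuous_on_sqrt_op with (M := M + (norm (A p) + (b - a) * norm (A q))).
    - intros s Hs; split; [now apply De | ].
      rewrite Ae by exact Hs; eapply Rle_trans; [apply norm_minus_le | ].
      apply Rplus_le_compat; [now apply HM | ].
      rewrite Av; eapply Rle_trans; [apply (@norm_triangle R_AbsRing H) | ].
      rewrite norm_scal_eq, Rabs_pos_eq by lra.
      generalize (norm_ge_0 (A q)); nra.
    - exact (has_deriv_continuous_on (V := H) a b e _ He). }
  (* A need not be continuous here: A v is affine in time, with coefficients A p and A q. *)
  assert (Cr : continuous_on (fun s => a <= s <= b) r).
  { assert (CV : continuous_on (fun s => a <= s <= b)
      (fun s => minus (plus (plus q (A p)) (scal (s - a) (A q))) (f s))).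
    { apply (continuous_on_minus (V := H)); [ | exact Hf].
      apply (has_deriv_continuous_on (V := H) a b _ (fun _ => A q)).
      intros; apply has_deriv_affine. }
    intros s Hs P HP.
    assert (Hr : forall s, r s = minus (plus (plus q (A p)) (scal (s - a) (A q))) (f s)).
    { intros s'; unfold r; rewrite Av; vec_ring. }
    rewrite Hr in HP; destruct (CV s Hs P HP) as [d Hd].
    exists d; intros s' Hss' Hs'; rewrite Hr; now apply Hd. }
  assert (Cd : continuous_on (fun s => a <= s <= b) (fun s => dual_norm B (r s) ^ 2)).
  { apply (continuous_on_norm_sqr (V := H) a b (fun s => inv_op B (r s))).
    exact (continuous_on_inv_op B B_linear B_self_adjoint _ poincare inv_sqrt_pos a b r Cr). }
  assert (Ce' := continuous_on_sub a b a t _ (Rle_refl a) (proj2 Ht) Ce).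
  assert (Cd' := continuous_on_sub a b a t _ (Rle_refl a) (proj2 Ht) Cd).
  assert (Ie : ex_RInt (fun s => energy_norm B (e s) ^ 2) a t)
    by now apply (continuous_on_ex_RInt (V := R_CompleteNormedModule)).
  assert (Id : ex_RInt (fun s => dual_norm B (r s) ^ 2) a t)
    by now apply (continuous_on_ex_RInt (V := R_CompleteNormedModule)).
  split; [exact Ie | split; [exact Id | ]].
  assert (Hmain : norm (e t) ^ 2 - norm (e a) ^ 2
    <= RInt (fun s => dual_norm B (r s) ^ 2 - energy_norm B (e s) ^ 2) a t).
  { apply (has_deriv_le_RInt a t (fun s => norm (e s) ^ 2)
      (fun s => 2 * inner (minus (u' s) q) (e s))); [easy | | | ].
    - intros s Hs; apply has_deriv_norm_sqr, (has_deriv_sub a b); try lra.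
      apply He; lra.
    - exact (continuous_on_minus (V := R_NormedModule) a t _ _ Cd' Ce').
    - intros s Hs.
      destruct (inv_op_spec B B_linear B_self_adjoint _ poincare inv_sqrt_pos (r s)) as [Dw Bw].
      unfold dual_norm, energy_norm; set (w := inv_op B (r s)) in *.
      destruct (Heq s ltac:(lra)) as [Du Eu].
      assert (Des := De s ltac:(lra)).
      (* Here u' - q = -(A e + r), r = B w, and (B w, e) = (w, B e). The final square (|w| - |B
         e|)^2 >= 0 is Young's inequality. *)
      assert (Hi : inner (minus (u' s) q) (e s)
        = - norm (B (e s)) ^ 2 - inner w (B (e s))).
      { rewrite <- (self_adjoint_inner B B_self_adjoint) by (auto using sqrt_op_dom).
        rewrite (sqrt_op_norm_sqr _ Des), Ae, Bw by lra.
        unfold r; rewrite <- Eu; repeat inner_expand; ring. }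
      assert (HC := Cauchy_Schwarz w (B (e s))).
      apply Rabs_le_between in HC.
      generalize (pow2_ge_0 (norm w - norm (B (e s)))); nra. }
  assert (Hm : RInt (fun s => dual_norm B (r s) ^ 2 - energy_norm B (e s) ^ 2) a t
    = RInt (fun s => dual_norm B (r s) ^ 2) a t - RInt (fun s => energy_norm B (e s) ^ 2) a t)
    by exact (RInt_minus (V := R_CompleteNormedModule) _ _ a t Id Ie).
  lra.
Qed.

End EnergyEstimate.

(** * The partition and the nodal values *)

Section Partition.

Context (N : nat) (T : R) (tn : nat -> R).
Hypothesis tn_partition : partition N T tn.

Lemma partition_mono i j : (i <= j)%nat -> (j <= N)%nat -> tn i <= tn j.
Proof.
  destruct tn_partition as [_ [_ [_ Hlt]]].
  intros Hij; induction Hij as [ | j Hij IH]; intros Hj; [lra | ].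
  specialize (Hlt j ltac:(lia)); specialize (IH ltac:(lia)); lra.
Qed.

Lemma cell_interval m s : (m < N)%nat -> tn m < s <= tn (S m) -> cell tn N s = m.
Proof.
  intros Hm Hs.
  assert (Hn : forall n, (m < n)%nat -> (n <= N)%nat -> cell tn n s = m).
  { intros n; induction n as [ | n IH]; intros H1 H2; [lia | ]; simpl.
    destruct (Rlt_dec (tn n) s) as [Hlt | Hnlt].
    - destruct (Nat.eq_dec n m) as [E | E]; [exact E | ].
      assert (Hle := partition_mono (S m) n ltac:(lia) ltac:(lia)); lra.
    - destruct (Nat.eq_dec n m) as [E | E]; [subst n; lra | apply IH; lia]. }
  apply Hn; lia.
Qed.

Lemma cell_start : cell tn N (tn 0%nat) = 0%nat.
Proof.
  assert (Hn : forall n, (n <= N)%nat -> cell tn n (tn 0%nat) = 0%nat).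
  { intros n; induction n as [ | n IH]; intros Hle; [easy | ]; simpl.
    destruct (Rlt_dec (tn n) (tn 0%nat)) as [Hlt | _]; [ | apply IH; lia].
    assert (Hm := partition_mono 0 n ltac:(lia) ltac:(lia)); lra. }
  now apply Hn.
Qed.

Lemma partition_cover s : 0 <= s <= T -> exists m, (m < N)%nat /\ tn m <= s <= tn (S m).
Proof.
  destruct tn_partition as [HN [H0 [HT _]]].
  intros Hs.
  assert (Hn : forall n, (1 <= n)%nat -> (n <= N)%nat -> s <= tn n ->
    exists m, (m < N)%nat /\ tn m <= s <= tn (S m)).
  { intros n; induction n as [ | n IH]; intros H1 H2 Hle; [lia | ].
    destruct (Rle_lt_dec (tn n) s) as [Hns | Hns].
    - exists n; split; [lia | lra].
    - destruct n as [ | n]; [lra | apply IH; [lia | lia | lra]]. }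
  apply (Hn N); [lia | lia | lra].
Qed.

Context {H : HilbertSpace} (E : R -> H -> H) (f : R -> H) (u0 : H).

Let node := midpoint_node E f u0 tn.

Lemma midpoint_slope_interval m s :
  (m < N)%nat -> tn m < s <= tn (S m) ->
  midpoint_slope E f u0 N tn s
    = scal (/ (tn (S m) - tn m)) (minus (node (S m)) (node m)).
Proof. intros Hm Hs; unfold midpoint_slope; now rewrite (cell_interval m s Hm Hs). Qed.

(** Unlike the slope formula this includes the left node: there [cell] selects the previous
    interval, whose formula gives the same nodal value, which is the continuity of U. At s = 0
    [cell] falls through to 0, the right index already. *)
Lemma midpoint_approx_interval m s :
  (m < N)%nat -> tn m <= s <= tn (S m) ->
  midpoint_approx E f u0 N tn s
    = plus (node m) (scal (s - tn m)
        (scal (/ (tn (S m) - tn m)) (minus (node (S m)) (node m)))).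
Proof.
  destruct tn_partition as [_ [_ [_ Hlt]]].
  intros Hm [[Hs | <-] Hs'].
  - unfold midpoint_approx; rewrite (midpoint_slope_interval m) by lra || lia.
    now rewrite (cell_interval m) by lra || lia.
  - destruct m as [ | m].
    + unfold midpoint_approx, midpoint_slope; now rewrite cell_start.
    + assert (Hl := Hlt m ltac:(lia)); assert (Hl' := Hlt (S m) Hm).
      unfold midpoint_approx; rewrite (midpoint_slope_interval m) by lra || lia.
      rewrite (cell_interval m) by lra || lia; fold node.
      vec_simpl; field; lra.
Qed.

Variable A : operator H.
Hypothesis A_linear : linear_op A.
Hypothesis E_exp : exp_minus A E.
Hypothesis u0_dom : dom A u0.

Lemma midpoint_node_dom n : (n <= N)%nat -> dom A (node n).
Proof.
  destruct tn_partition as [_ [_ [_ Hlt]]].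
  unfold node; induction n as [ | n IH]; intros Hn; [exact u0_dom | ]; simpl.
  specialize (Hlt n ltac:(lia)).
  apply op_dom_plus; [exact A_linear | | ].
  - apply semigroup_dom; [apply E_exp | exact E_exp | lra | apply IH; lia].
  - apply phi1_dom; [apply E_exp | exact E_exp | lra].
Qed.

Lemma midpoint_slope_dom m :
  (m < N)%nat -> dom A (scal (/ (tn (S m) - tn m)) (minus (node (S m)) (node m))).
Proof.
  intros Hm; apply op_dom_scal, op_dom_minus; try exact A_linear;
    apply midpoint_node_dom; lia.
Qed.

Lemma midpoint_approx_dom s : 0 <= s <= T -> dom A (midpoint_approx E f u0 N tn s).
Proof.
  intros Hs; destruct (partition_cover s Hs) as [m [Hm Hsm]].
  rewrite (midpoint_approx_interval m s Hm Hsm).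
  apply op_dom_plus, op_dom_scal, midpoint_slope_dom; try assumption.
  apply midpoint_node_dom; lia.
Qed.

End Partition.

Theorem theorem1
  (H : HilbertSpace) (A Ahalf : operator H) (lambda1 : R) (E : R -> H -> H)
  (T : R) (u0 : H) (f u : R -> H) (N : nat) (tn : nat -> R)
  (A_linear : linear_op A)
  (A_dense : densely_defined A)
  (A_self_adjoint : self_adjoint A)
  (A_positive : positive_definite A)
  (Ahalf_sqrt : is_sqrt_op A Ahalf)
  (lambda1_pos : 0 < lambda1)
  (lambda1_first : first_eigenvalue A lambda1)
  (poincare : forall v, dom Ahalf v ->
     norm v <= / sqrt lambda1 * energy_norm Ahalf v)
  (E_exp : exp_minus A E)
  (u0_dom : dom A u0)
  (f_smooth : C2_on 0 T f)
  (tn_partition : partition N T tn)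
  (u_solution : exact_solution A f u0 T u) :
  let U := midpoint_approx E f u0 N tn in
  let Res := residual A E f u0 N tn in
  let e := fun s : R => minus (u s) (U s) in
  (forall s, 0 <= s <= T -> dom A (U s)) /\
  forall t, 0 <= t <= T ->
    ex_RInt (fun s => energy_norm Ahalf (e s) ^ 2) 0 t /\
    ex_RInt (fun s => dual_norm Ahalf (Res s) ^ 2) 0 t /\
    norm (e t) ^ 2 + RInt (fun s => energy_norm Ahalf (e s) ^ 2) 0 t
      <= RInt (fun s => dual_norm Ahalf (Res s) ^ 2) 0 t.
Proof.
  intros U Res e.
  split; [intros s Hs; now apply (midpoint_approx_dom N T tn) | ].
  destruct u_solution as [Hu0 [u' [Hu' Heq]]].
  assert (Hpart := tn_partition); destruct Hpart as [HN [Ht0 [HtN Hlt]]].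
  assert (HT : 0 < T).
  { assert (H1 := Hlt 0%nat ltac:(lia)).
    assert (H2 := partition_mono N T tn tn_partition 1 N HN (Nat.le_refl N)); lra. }
  assert (Hu : forall t, 0 <= t <= T -> has_deriv 0 T u t (u' t))
    by (intros; now apply derivative_on_has_deriv).
  destruct f_smooth as [f1 [f2 [Hf1 [Hf2 _]]]].
  assert (Hf : forall t, 0 <= t <= T -> has_deriv 0 T f t (f1 t))
    by (intros; now apply derivative_on_has_deriv).
  assert (Cf : continuous_on (fun s => 0 <= s <= T) f)
    by exact (has_deriv_continuous_on (V := H) 0 T f f1 Hf).
  assert (Cf1 : continuous_on (fun s => 0 <= s <= T) f1).
  { apply (has_deriv_continuous_on (V := H) 0 T f1 f2).
    intros; now apply derivative_on_has_deriv. }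
  (* The bound on f' is the Lipschitz constant of f needed for comparing translates of u. *)
  destruct (continuous_on_bounded (V := H) 0 T f1 ltac:(lra) Cf1) as [L [_ HL]].
  destruct (continuous_on_bounded (V := H) 0 T f ltac:(lra) Cf) as [M [_ HM]].
  destruct (solution_derivative_bounded A Ahalf lambda1 A_linear Ahalf_sqrt lambda1_pos
    poincare T L f u u' HT Hu Heq (has_deriv_lipschitz 0 T f f1 L Hf HL)) as [C HC].
  assert (HAu : forall t, 0 <= t <= T -> norm (A (u t)) <= M + C).
  { intros t Ht; destruct (Heq t Ht) as [_ Et].
    assert (Hs : A (u t) = minus (f t) (u' t)) by (rewrite <- Et; vec_ring).
    rewrite Hs; eapply Rle_trans; [apply norm_minus_le | ].
    apply Rplus_le_compat; [now apply HM | now apply HC]. }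
  (* Induction over the nodes: the bound at the node [tn m] supplies the initial term |e|^2 of the
     next cell. *)
  assert (Hind : forall m, (m <= N)%nat -> forall t, 0 <= t <= tn m ->
    ex_RInt (fun s => energy_norm Ahalf (e s) ^ 2) 0 t /\
    ex_RInt (fun s => dual_norm Ahalf (Res s) ^ 2) 0 t /\
    norm (e t) ^ 2 + RInt (fun s => energy_norm Ahalf (e s) ^ 2) 0 t
      <= RInt (fun s => dual_norm Ahalf (Res s) ^ 2) 0 t).
  2:{ intros t Ht; apply (Hind N); [lia | lra]. }
  intros m; induction m as [ | m IH]; intros Hm t Ht.
  - assert (t = 0) as -> by lra.
    split; [apply ex_RInt_point | split; [apply ex_RInt_point | ]].
    rewrite !RInt_point.
    assert (He0 : e 0 = zero).
    { unfold e, U; rewrite (midpoint_approx_interval N T tn tn_partition E f u0 0) by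
        (lia || (specialize (Hlt 0%nat ltac:(lia)); lra)).
      rewrite Hu0, Ht0; simpl; vec_ring. }
    rewrite (norm_zero_eq (e 0) He0).
    change (0 ^ 2 + 0 <= 0); lra.
  - destruct (Rle_lt_dec t (tn m)) as [Htm | Htm]; [apply IH; [lia | lra] | ].
    assert (Hm0 : 0 <= tn m).
    { rewrite <- Ht0; apply (partition_mono N T tn tn_partition); lia. }
    assert (HmT : tn (S m) <= T).
    { rewrite <- HtN; apply (partition_mono N T tn tn_partition); lia. }
    destruct (IH ltac:(lia) (tn m) ltac:(lra)) as [Ie [Id Hle]].
    set (p := midpoint_node E f u0 tn m).
    set (q := scal (/ (tn (S m) - tn m)) (minus (midpoint_node E f u0 tn (S m)) p)).
    destruct (energy_inequality A Ahalf lambda1 A_linear Ahalf_sqrt lambda1_pos poincare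
      (tn m) (tn (S m)) p q f u u' (M + C)
      (fun s Hs => has_deriv_sub 0 T _ _ u s (u' s) Hm0 HmT (Hu s ltac:(lra)))
      (fun s Hs => Heq s ltac:(lra)) (fun s Hs => HAu s ltac:(lra))
      (continuous_on_sub 0 T _ _ f Hm0 HmT Cf)
      (midpoint_node_dom N T tn tn_partition E f u0 A A_linear E_exp u0_dom m ltac:(lia))
      (midpoint_slope_dom N T tn tn_partition E f u0 A A_linear E_exp u0_dom m ltac:(lia))
      t ltac:(lra)) as [Ie' [Id' Hle']].
    assert (HU : forall s, tn m <= s <= tn (S m) -> U s = plus p (scal (s - tn m) q))
      by (intros s Hs; exact (midpoint_approx_interval N T tn tn_partition E f u0 m s Hm Hs)).
    assert (He : forall s, tn m <= s <= tn (S m) ->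
      e s = minus (u s) (plus p (scal (s - tn m) q)))
      by (intros s Hs; unfold e; now rewrite (HU s Hs)).
    (* At [tn m] the residual carries the slope of the previous cell (if m > 0), so the left end is
       excluded; the integrals only see the open interval. *)
    assert (HR : forall s, tn m < s <= tn (S m) ->
      Res s = minus (plus q (A (plus p (scal (s - tn m) q)))) (f s)).
    { intros s Hs; unfold Res, residual; fold U; rewrite (HU s) by lra.
      now rewrite (midpoint_slope_interval N T tn tn_partition E f u0 m s Hm Hs). }
    simpl in Ie', Id', Hle'.
    assert (Ee : forall s, Rmin (tn m) t < s < Rmax (tn m) t ->
      energy_norm Ahalf (minus (u s) (plus p (scal (s - tn m) q))) ^ 2
      = energy_norm Ahalf (e s) ^ 2).
    { intros s; rewrite Rmin_left, Rmax_right by lra; intros Hs; now rewrite He by lra. }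
    assert (Ed : forall s, Rmin (tn m) t < s < Rmax (tn m) t ->
      dual_norm Ahalf (minus (plus q (A (plus p (scal (s - tn m) q)))) (f s)) ^ 2
      = dual_norm Ahalf (Res s) ^ 2).
    { intros s; rewrite Rmin_left, Rmax_right by lra; intros Hs; now rewrite HR by lra. }
    assert (Re := RInt_ext (V := R_CompleteNormedModule) _ _ _ _ Ee).
    assert (Rd := RInt_ext (V := R_CompleteNormedModule) _ _ _ _ Ed).
    apply (ex_RInt_ext (V := R_NormedModule) _ _ _ _ Ee) in Ie'.
    apply (ex_RInt_ext (V := R_NormedModule) _ _ _ _ Ed) in Id'.
    assert (Hcell : norm (e t) ^ 2 + RInt (fun s => energy_norm Ahalf (e s) ^ 2) (tn m) t
      <= norm (e (tn m)) ^ 2 + RInt (fun s => dual_norm Ahalf (Res s) ^ 2) (tn m) t).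
    { rewrite <- Re, <- Rd, (He t), (He (tn m)) by lra; exact Hle'. }
    split; [exact (ex_RInt_Chasles _ _ _ _ Ie Ie') | ].
    split; [exact (ex_RInt_Chasles _ _ _ _ Id Id') | ].
    rewrite <- (RInt_Chasles (V := R_CompleteNormedModule) _ _ _ _ Ie Ie').
    rewrite <- (RInt_Chasles (V := R_CompleteNormedModule) _ _ _ _ Id Id').
    change (@plus R_CompleteNormedModule) with Rplus; lra.
Qed.
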